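(* There is an algorithm which, given a trapezoid model $\tau$ consisting of $n$ trapezoids, outputs a maximum induced matching of the trapezoid graph $G(\tau)$ in $\mathcal{O}(m+n)$ time, where $m$ is the number of edges of $G(\tau)$.
   Context: A trapezoid model is a set $\tau$ of $n$ trapezoids between two parallel horizontal lines (the $x$-axis and the $y$-axis); each trapezoid $A$ is given by four values $A.x_1\le A.x_2$ and $A.y_1\le A.y_2$, where $[A.x_1,A.x_2]$ is an interval on the $x$-axis and $[A.y_1,A.y_2]$ an interval on the $y$-axis; the trapezoid is the convex hull of these two intervals. It is assumed that all $x$-coordinates of all trapezoids are mutually distinct, all $y$-coordinates are mutually distinct, and all are integers in $[1,2n]$. The trapezoid graph $G(\tau)$ has one vertex per trapezoid, and $AB$ is an edge iff the trapezoids $A$ and $B$ intersect (equivalently, a diagonal of $A$ — the segment from $x_1$ to $y_2$ or from $x_2$ to $y_1$ — intersects a diagonal of $B$). An induced matching of $G=(V,E)$ is a set $M\subseteq E$ such that for any two distinct edges $u_1v_1,u_2v_2\in M$, none of $u_1u_2,u_1v_2,v_1u_2,v_1v_2$ is in $E$; a maximum induced matching is one of maximum cardinality. Running times are in the standard RAM model. *)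

(* Defs.v *)
From mathcomp Require Import all_boot all_order all_algebra.
Set Implicit Arguments. Unset Strict Implicit. Unset Printing Implicit Defensive.
Import Order.TTheory GRing.Theory Num.Theory.

(* A trapezoid: interval [x1,x2] on the lower line, [y1,y2] on the upper one *)
Record trap := Trap { tx1 : nat; tx2 : nat; ty1 : nat; ty2 : nat }.

Definition xcoords (tau : seq trap) : seq nat :=
  flatten [seq [:: tx1 A; tx2 A] | A <- tau].
Definition ycoords (tau : seq trap) : seq nat :=
  flatten [seq [:: ty1 A; ty2 A] | A <- tau].

Definition trapezoid_model (tau : seq trap) : Prop :=
  [/\ all (fun A => tx1 A <= tx2 A) tau,
      all (fun A => ty1 A <= ty2 A) tau,
      uniq (xcoords tau), uniq (ycoords tau)
    & all (fun v => 1 <= v <= 2 * size tau) (xcoords tau)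
      /\ all (fun v => 1 <= v <= 2 * size tau) (ycoords tau)].

(* The trapezoid A as a point set in the plane: the lower line is {y = 0},
   the upper line is {y = 1}.  The convex hull of [x1,x2]x{0} and
   [y1,y2]x{1} is the set of points ((1-s) a + s b, s) with s in [0,1],
   a in [x1,x2], b in [y1,y2].  Coordinates are taken in the rationals
   (all data is integral, so this is the same as over the reals). *)
Definition in_trap (A : trap) (p : rat * rat) : Prop :=
  exists (s a b : rat),
    [/\ 0 <= s <= 1,
        (tx1 A)%:R <= a <= (tx2 A)%:R,
        (ty1 A)%:R <= b <= (ty2 A)%:R
      & p = ((1 - s) * a + s * b, s)]%R.

Definition traps_intersect (A B : trap) : Prop :=
  exists p, in_trap A p /\ in_trap B p.

Definition tg_adj (tau : seq trap) (i j : nat) : Prop :=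
  [/\ i < size tau, j < size tau, i != j
    & traps_intersect (nth (Trap 0 0 0 0) tau i) (nth (Trap 0 0 0 0) tau j)].

Definition num_edges (tau : seq trap) (m : nat) : Prop :=
  exists E : seq (nat * nat),
    [/\ uniq E,
        forall p, p \in E <-> (p.1 < p.2 /\ tg_adj tau p.1 p.2)
      & size E = m].

(* Induced matchings.  A set of edges is given as a list of vertex pairs;   *)
(* the edge {u,v} is represented by (u,v) or (v,u).                          *)

Definition unord (p : nat * nat) : nat * nat := (minn p.1 p.2, maxn p.1 p.2).

Definition induced_matching (tau : seq trap) (M : seq (nat * nat)) : Prop :=
  [/\ forall e, e \in M -> tg_adj tau e.1 e.2,
      uniq (map unord M)
    & forall e f, e \in M -> f \in M -> unord e != unord f ->
        [/\ ~ tg_adj tau e.1 f.1, ~ tg_adj tau e.1 f.2,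
            ~ tg_adj tau e.2 f.1 & ~ tg_adj tau e.2 f.2]].

Definition max_induced_matching (tau : seq trap) (M : seq (nat * nat)) : Prop :=
  induced_matching tau M /\
  forall M', induced_matching tau M' -> size M' <= size M.

(* Unit-cost RAM (Cook--Reckhow style): infinitely many registers holding   *)
(* natural numbers, direct and indirect addressing, addition, truncated     *)
(* subtraction, comparison jumps, and read-only input / write-only output.  *)
(* Each executed instruction costs one time unit.                           *)

Inductive instr :=
| IConst of nat & nat
| IAdd   of nat & nat & nat
| ISub   of nat & nat & nat
| ILoad  of nat & nat
| IStore of nat & nat
| IJlt   of nat & nat & nat
| IJmp   of nat
| IRead  of nat
| IWrite of nat
| IHalt.

Record ram_state := RS {
  rs_pc : nat; rs_mem : nat -> nat; rs_in : seq nat; rs_out : seq nat }.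

Definition upd (m : nat -> nat) (a v : nat) : nat -> nat :=
  fun x => if x == a then v else m x.

(* One step; None when the machine has halted (IHalt, or pc outside P). *)
Definition ram_step (P : seq instr) (s : ram_state) : option ram_state :=
  let: RS pc m inp out := s in
  match nth IHalt P pc with
  | IConst r k => Some (RS pc.+1 (upd m r k) inp out)
  | IAdd r a b => Some (RS pc.+1 (upd m r (m a + m b)) inp out)
  | ISub r a b => Some (RS pc.+1 (upd m r (m a - m b)) inp out)
  | ILoad r a => Some (RS pc.+1 (upd m r (m (m a))) inp out)
  | IStore a r => Some (RS pc.+1 (upd m (m a) (m r)) inp out)
  | IJlt a b l => Some (RS (if m a < m b then l else pc.+1) m inp out)
  | IJmp l => Some (RS l m inp out)
  | IRead r => Some (RS pc.+1 (upd m r (head 0 inp)) (behead inp) out)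
  | IWrite r => Some (RS pc.+1 m inp (rcons out (m r)))
  | IHalt => None
  end.

Fixpoint ram_run (P : seq instr) (t : nat) (s : ram_state) : option ram_state :=
  match ram_step P s with
  | None => Some s
  | Some s' => if t is t'.+1 then ram_run P t' s' else None
  end.

Definition ram_init (inp : seq nat) : ram_state := RS 0 (fun _ => 0) inp [::].

Definition encode_model (tau : seq trap) : seq nat :=
  size tau :: flatten [seq [:: tx1 A; tx2 A; ty1 A; ty2 A] | A <- tau].

Definition encode_pairs (M : seq (nat * nat)) : seq nat :=
  flatten [seq [:: e.1; e.2] | e <- M].

(* Main.v *)
Require Import Defs.
From mathcomp Require Import all_boot all_order all_algebra.
From mathcomp Require Import zify ring lra.
Set Implicit Arguments. Unset Strict Implicit. Unset Printing Implicit Defensive.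

(* Call A left of B when A ends before B begins on both lines; two trapezoids
   intersect iff neither is left of the other.  In an induced matching the
   bounding boxes of the edges form a chain for this order, so the task is to
   find a longest chain of edge boxes.

   Sweep x from left to right and keep in T[v] the least upper right coordinate
   of a chain of v edges lying before x.  When x = A.x1, let f(A) be the largest
   v with T[v] <= A.y1 and freeze t(A) = T[f(A)].  When x = C.x2, every edge
   {C, D} with D.x2 < x is complete; let A be its end with smaller x1 and B the
   other one.  If t(A) <= B.y1, the edge prolongs the chain recorded for A and
   T[f(A) + 1] is updated; otherwise a chain of f(A) edges lies entirely to the
   left of A, is at least as long as any chain ending with AB, and ends lower,
   so that the edge can be ignored.

   Time: looking for f(A) downwards from the top of T skips edges which lie
   before A.x1 but above A.y1, each of which contains a neighbour of A.  The
   neighbours D of C with D.x2 < C.x2 are found by walking down the list of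
   finished trapezoids sorted by y2 while D.y2 > C.y1, and by scanning the
   abscissas between C.x1 and C.x2, all of which belong to neighbours of C;
   inserting C in the list costs at most its degree as well. *)

(** * A structured language over the RAM *)

Inductive atom :=
| AConst of nat & nat
| AAdd   of nat & nat & nat
| ASub   of nat & nat & nat
| ALoad  of nat & nat & nat
| AStore of nat & nat & nat
| ARead  of nat
| AWrite of nat.

Inductive cmd :=
| Block of seq atom
| Seq of cmd & cmd
| If of nat & nat & cmd & cmd
| While of nat & nat & cmd.

Notation "c1 ;; c2" := (Seq c1 c2) (at level 90, right associativity).

(* [tm] is ghost: at most [8 * tm] RAM steps have been made so far. *)
Record st := St {
  sc : nat -> nat; ar : nat -> nat -> nat; inp : seq nat; out : seq nat;
  tm : nat }.

Definition set_sc (s : st) (r v : nat) : st :=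
  St (upd (sc s) r v) (ar s) (inp s) (out s) (tm s).+1.

Definition aexec (s : st) (a : atom) : st :=
  match a with
  | AConst r k => set_sc s r k
  | AAdd r a b => set_sc s r (sc s a + sc s b)
  | ASub r a b => set_sc s r (sc s a - sc s b)
  | ALoad r k i => set_sc s r (ar s k (sc s i))
  | AStore k i r =>
      St (sc s)
         (fun k' => if k' == k then upd (ar s k') (sc s i) (sc s r) else ar s k')
         (inp s) (out s) (tm s).+1
  | ARead r =>
      St (upd (sc s) r (head 0 (inp s))) (ar s) (behead (inp s)) (out s) (tm s).+1
  | AWrite r => St (sc s) (ar s) (inp s) (rcons (out s) (sc s r)) (tm s).+1
  end.

Definition tick (s : st) : st := St (sc s) (ar s) (inp s) (out s) (tm s).+1.

Inductive exec : cmd -> st -> st -> Prop :=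
| EBlock l s : exec (Block l) s (foldl aexec s l)
| ESeq c1 c2 s s1 s2 : exec c1 s s1 -> exec c2 s1 s2 -> exec (c1 ;; c2) s s2
| EIfT a b c1 c2 s s' : sc s a < sc s b -> exec c1 (tick s) s' ->
    exec (If a b c1 c2) s s'
| EIfF a b c1 c2 s s' : sc s b <= sc s a -> exec c2 (tick s) s' ->
    exec (If a b c1 c2) s s'
| EWhT a b c s s1 s2 : sc s a < sc s b -> exec c (tick s) s1 ->
    exec (While a b c) s1 s2 -> exec (While a b c) s s2
| EWhF a b c s : sc s b <= sc s a -> exec (While a b c) s (tick s).

(* Scalar [v < 30] lives in register [v]; cell [i] of array [k < 32] lives in
   register [32 * (i + 1) + k]; registers 30 and 31 are scratch. *)
Definition addr_code (k i : nat) : seq instr :=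
  [:: IAdd 31 i i; IAdd 31 31 31; IAdd 31 31 31; IAdd 31 31 31; IAdd 31 31 31;
      IConst 30 (32 + k); IAdd 31 31 30].

Definition acode (a : atom) : seq instr :=
  match a with
  | AConst r k => [:: IConst r k]
  | AAdd r a b => [:: IAdd r a b]
  | ASub r a b => [:: ISub r a b]
  | ALoad r k i => addr_code k i ++ [:: ILoad r 31]
  | AStore k i r => addr_code k i ++ [:: IStore 31 r]
  | ARead r => [:: IRead r]
  | AWrite r => [:: IWrite r]
  end.

Definition awf (a : atom) : bool :=
  match a with
  | AConst r _ | ARead r | AWrite r => r < 30
  | AAdd r a b | ASub r a b => [&& r < 30, a < 30 & b < 30]
  | ALoad r k i | AStore k i r => [&& r < 30, k < 32 & i < 30]
  end.

Fixpoint code (off : nat) (c : cmd) : seq instr :=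
  match c with
  | Block l => flatten (map acode l)
  | Seq c1 c2 => let p1 := code off c1 in p1 ++ code (off + size p1) c2
  | If a b c1 c2 =>
      let p2 := code (off + 1) c2 in
      let off1 := off + size p2 + 2 in
      let p1 := code off1 c1 in
      IJlt a b off1 :: p2 ++ IJmp (off1 + size p1) :: p1
  | While a b c =>
      let p := code (off + 2) c in
      [:: IJlt a b (off + 2), IJmp (off + size p + 3) & rcons p (IJmp off)]
  end.

Fixpoint wf (c : cmd) : bool :=
  match c with
  | Block l => all awf l
  | Seq c1 c2 => wf c1 && wf c2
  | If a b c1 c2 => [&& a < 30, b < 30, wf c1 & wf c2]
  | While a b c => [&& a < 30, b < 30 & wf c]
  end.

(** * Simulation of the structured language by the RAM *)

Definition rep (m : nat -> nat) (s : st) : Prop :=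
  (forall v, v < 30 -> m v = sc s v) /\
  (forall k i, k < 32 -> m (32 * i.+1 + k) = ar s k i).

Fixpoint steps (P : seq instr) (t : nat) (s : ram_state) : option ram_state :=
  if t is t'.+1 then obind (steps P t') (ram_step P s) else Some s.

Lemma steps_add P t1 t2 s s1 :
  steps P t1 s = Some s1 -> steps P (t1 + t2) s = steps P t2 s1.
Proof.
elim: t1 s => [|t IH] s /=; first by case=> ->.
by case: (ram_step P s) => //= s' /IH.
Qed.

Lemma ram_run_halt P t t' s s' :
  steps P t s = Some s' -> ram_step P s' = None -> t <= t' ->
  ram_run P t' s = Some s'.
Proof.
elim: t t' s => [|t IH] [|t'] s //=.
- by case=> -> ->.
- by case=> -> ->.
by case: (ram_step P s) => //= s1 /IH; apply.
Qed.

Definition code_at (P : seq instr) (off : nat) (q : seq instr) : Prop :=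
  forall i, i < size q -> nth IHalt P (off + i) = nth IHalt q i.

Lemma code_at_cat P off q1 q2 :
  code_at P off (q1 ++ q2) -> code_at P off q1 /\ code_at P (off + size q1) q2.
Proof.
move=> H; split=> i Hi.
  by rewrite H ?nth_cat ?Hi // size_cat; lia.
rewrite -addnA H ?nth_cat ?size_cat; last by lia.
by rewrite ltnNge leq_addr /= addKn.
Qed.

Lemma code_at_cons P off a q :
  code_at P off (a :: q) -> nth IHalt P off = a /\ code_at P off.+1 q.
Proof.
move=> H; split; first by rewrite -[off]addn0 H.
by move=> i Hi; rewrite addSnnS H.
Qed.

(** Five doublings give [32 * m i] without a multiplication; only the scratch registers are lost. *)
Lemma steps_addr P pc k i m ip o :
  code_at P pc (addr_code k i) -> i < 30 ->
  exists m', [/\ steps P 7 (RS pc m ip o) = Some (RS (pc + 7) m' ip o),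
    m' 31 = 32 * (m i).+1 + k & forall v, v <> 30 -> v <> 31 -> m' v = m v].
Proof.
rewrite /addr_code => /code_at_cons[H0] /code_at_cons[H1] /code_at_cons[H2].
move=> /code_at_cons[H3] /code_at_cons[H4] /code_at_cons[H5] /code_at_cons[H6] _ Hi.
rewrite /steps /= H0 /= H1 /= H2 /= H3 /= H4 /= H5 /= H6 /=.
eexists; split; first by do 2 f_equal; lia.
  by rewrite /upd /=; lia.
by move=> v /eqP/negbTE n1 /eqP/negbTE n2; rewrite /upd n1 n2.
Qed.

(** Array accesses are the dearest atoms: seven instructions for the address and one for the access,
    whence the factor 8. *)
Lemma atom_correct P off a s m :
  awf a -> code_at P off (acode a) -> rep m s ->
  exists t m', [/\ rep m' (aexec s a), 8 * tm s + t <= 8 * tm (aexec s a) &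
    steps P t (RS off m (inp s) (out s)) =
    Some (RS (off + size (acode a)) m' (inp (aexec s a)) (out (aexec s a)))].
Proof.
have rep_upd r v m0 s0 ip o t : r < 30 -> rep m0 s0 ->
    rep (upd m0 r v) (St (upd (sc s0) r v) (ar s0) ip o t).
  move=> Hr [H1 H2]; split=> [w Hw|k i Hk] /=; rewrite /upd.
    by rewrite H1.
  by rewrite H2 // ifF //; lia.
case: a => [r k|r a b|r a b|r k i|k i r|r|r] /= wfa.
- move=> /code_at_cons[H _] R; exists 1; eexists.
  split; last by rewrite /= H /= addn1.
    exact: rep_upd.
  by rewrite /=; lia.
- case/and3P: wfa => ? ? ? /code_at_cons[H _] R; exists 1; eexists.
  split; last by rewrite /= H /= addn1.
    by rewrite !R.1 //; exact: rep_upd.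
  by rewrite /=; lia.
- case/and3P: wfa => ? ? ? /code_at_cons[H _] R; exists 1; eexists.
  split; last by rewrite /= H /= addn1.
    by rewrite !R.1 //; exact: rep_upd.
  by rewrite /=; lia.
- case/and3P: wfa => Hr Hk Hi H R.
  have /code_at_cat[Ha /code_at_cons[/= Hl _]] :
    code_at P off (addr_code k i ++ [:: ILoad r 31]) by [].
  have [m1 [S1 E1 E2]] := steps_addr m (inp s) (out s) Ha Hi.
  exists 8; eexists; split; last first.
  + by rewrite (steps_add 1 S1 : steps P 8 _ = _) /= Hl /= -addnS.
  + by rewrite /=; lia.
  rewrite E1 E2; [|lia..]; rewrite R.2 // R.1 //.
  apply: rep_upd => //; split=> [w Hw|k' i' Hk'].
    by rewrite E2; [exact: R.1|lia..].
  by rewrite E2; [exact: R.2|lia..].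
- case/and3P: wfa => Hr Hk Hi H R.
  have /code_at_cat[Ha /code_at_cons[/= Hl _]] :
    code_at P off (addr_code k i ++ [:: IStore 31 r]) by [].
  have [m1 [S1 E1 E2]] := steps_addr m (inp s) (out s) Ha Hi.
  exists 8; eexists; split; last first.
  + by rewrite (steps_add 1 S1 : steps P 8 _ = _) /= Hl /= -addnS.
  + by rewrite /=; lia.
  rewrite E1 [m1 r]E2; [|lia..].
  split=> [w Hw|k' i' Hk'] /=; rewrite /upd.
    by rewrite ifF ?E2 ?R.1 //; lia.
  case: (eqVneq k' k) => [->|nk].
    rewrite !R.1 //; case: (eqVneq i' (sc s i)) => [->|ni]; first by rewrite eqxx.
    by rewrite ifF ?E2 ?R.2 //; lia.
  rewrite ifF ?E2 ?R.2 //; lia.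
- move=> /code_at_cons[H _] R; exists 1; eexists.
  split; last by rewrite /= H /= addn1.
    exact: rep_upd.
  by rewrite /=; lia.
- move=> /code_at_cons[H _] R; exists 1; eexists.
  split; last by rewrite /= H /= addn1 R.1.
    by split; [exact: R.1|exact: R.2].
  by rewrite /=; lia.
Qed.

(** By induction on the big-step derivation. Each test of [If] or [While], with its jumps, takes at
    most two instructions, which the [tick] pays for. *)
Lemma code_correct P c s s' : exec c s s' ->
  forall off m, wf c -> code_at P off (code off c) -> rep m s ->
  exists t m', [/\ rep m' s', 8 * tm s + t <= 8 * tm s' &
    steps P t (RS off m (inp s) (out s)) =
    Some (RS (off + size (code off c)) m' (inp s') (out s'))].
Proof.
elim: c s s' / => [l s|c1 c2 s s1 s2 _ IH1 _ IH2|a b c1 c2 s s' L _ IH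
  |a b c1 c2 s s' L _ IH|a b c s s1 s2 L _ IH1 _ IH2|a b c s L] off m.
- elim: l s off m => [|a l IHl] s off m /=.
    by move=> _ _ R; exists 0, m; rewrite !addn0.
  move=> /andP[wa wl] /code_at_cat[Ha Hl] R.
  have [t [m1 [R1 T1 S1]]] := atom_correct wa Ha R.
  have [t' [m2 [R2 T2 S2]]] := IHl _ _ _ wl Hl R1.
  exists (t + t'), m2; split => //; first by lia.
  by rewrite (steps_add _ S1) S2 size_cat addnA.
- move=> /= /andP[w1 w2] /code_at_cat[H1 H2] R.
  have [t [m1 [R1 T1 S1]]] := IH1 _ _ w1 H1 R.
  have [t' [m2 [R2 T2 S2]]] := IH2 _ _ w2 H2 R1.
  exists (t + t'), m2; split => //; first by lia.
  by rewrite (steps_add _ S1) S2 size_cat addnA.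
- move=> /= /and4P[wa wb w1 w2] /code_at_cons[H0] /code_at_cat[H2] /code_at_cons[H3 H1] R.
  set off1 := (off + _ + 2) in H0 H1 *.
  have [|t [m1 [R1 T1 S1]]] := IH off1 _ w1 _ R.
    by move: H1; congr code_at; rewrite /off1; lia.
  exists t.+1, m1; split => //; first by move: T1 => /=; lia.
  rewrite /= H0 /= !R.1 // L S1; do 2 f_equal.
  by rewrite size_cat /= /off1; lia.
- move=> /= /and4P[wa wb w1 w2] /code_at_cons[H0] /code_at_cat[H2] /code_at_cons[H3 H1] R.
  set off1 := (off + _ + 2) in H0 H1 H3 *.
  have [|t [m1 [R1 T1 S1]]] := IH (off + 1) _ w2 _ R.
    by move: H2; congr code_at; lia.
  exists (t + 1).+1, m1; split => //; first by move: T1 => /=; lia.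
  rewrite /= H0 /= !R.1 // ltnNge L /= -[off.+1]addn1 (steps_add _ S1) /=.
  rewrite [off + 1 + _]addnAC addn1 -addSn H3 /=; do 2 f_equal.
  by rewrite size_cat /= /off1; lia.
- move=> /= /and3P[wa wb w] Hc R; have := Hc.
  rewrite -cats1 => /code_at_cons[H0] /code_at_cons[H1] /code_at_cat[H2] /code_at_cons[H3 _].
  have [|t [m1 [R1 T1 S1]]] := IH1 (off + 2) _ w _ R.
    by move: H2; congr code_at; lia.
  have [|t' [m2 [R2 T2 S2]]] := IH2 off _ _ Hc R1; first by rewrite /= wa wb.
  exists (t + t'.+1).+1, m2; split => //; first by move: T1 => /=; lia.
  rewrite /= H0 /= !R.1 // L (steps_add _ S1) /=.
  have -> : off + 2 + size (code (off + 2) c) = off.+2 + size (code (off + 2) c) by lia.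
  by rewrite H3 cats1 /= S2.
- move=> /= /and3P[wa wb w] /code_at_cons[H0] /code_at_cons[H1 _] R.
  exists 2, m; split => //; first by rewrite /=; lia.
  rewrite /= H0 /= !R.1 // ltnNge L /= H1 /=; do 2 f_equal.
  by rewrite size_rcons; lia.
Qed.

Definition st_init (ip : seq nat) : st := St (fun _ => 0) (fun _ _ => 0) ip [::] 0.

Lemma ram_run_code c ip s t :
  wf c -> exec c (st_init ip) s -> 8 * tm s <= t ->
  exists s', ram_run (code 0 c) t (ram_init ip) = Some s' /\ rs_out s' = out s.
Proof.
move=> w E L.
have [||t' [m' [_ T S]]] := @code_correct (code 0 c) c _ _ E 0 (fun _ => 0) w.
- by move=> i.
- by split.
exists (RS (0 + size (code 0 c)) m' (inp s) (out s)); split=> //.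
(* The run ends just past the code, where the default value of [nth] is [IHalt]. *)
apply: ram_run_halt S _ _; first by rewrite /= nth_default.
by move: T => /=; lia.
Qed.

(** * Weakest preconditions and frames *)

Definition wp (c : cmd) (Q : st -> Prop) (s : st) : Prop :=
  exists s', exec c s s' /\ Q s'.

Lemma wp_block l Q s : Q (foldl aexec s l) -> wp (Block l) Q s.
Proof. by move=> H; exists (foldl aexec s l); split=> //; constructor. Qed.

Lemma wp_seq c1 c2 Q s : wp c1 (wp c2 Q) s -> wp (c1 ;; c2) Q s.
Proof. by case=> s1 [E1 [s2 [E2 H]]]; exists s2; split=> //; apply: ESeq E1 E2. Qed.

Lemma wp_if a b c1 c2 Q s :
  (sc s a < sc s b -> wp c1 Q (tick s)) ->
  (sc s b <= sc s a -> wp c2 Q (tick s)) -> wp (If a b c1 c2) Q s.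
Proof.
move=> H1 H2; have [L|L] := ltnP (sc s a) (sc s b).
  by have [s' [E H]] := H1 L; exists s'; split=> //; apply: EIfT.
by have [s' [E H]] := H2 L; exists s'; split=> //; apply: EIfF.
Qed.

(** The index of the invariant bounds the remaining iterations and gives termination; the loop may
    be left at any index. *)
Lemma wp_while (I : nat -> st -> Prop) k a b c Q s :
  I k s ->
  (forall s, I 0 s -> sc s b <= sc s a) ->
  (forall k s, I k.+1 s -> sc s a < sc s b -> wp c (I k) (tick s)) ->
  (forall k s, I k s -> sc s b <= sc s a -> Q (tick s)) ->
  wp (While a b c) Q s.
Proof.
move=> H H0 HS HQ; elim: k s H => [|k IH] s H.
  by have L := H0 _ H; exists (tick s); split; [apply: EWhF|exact: HQ H L].
have [L|L] := ltnP (sc s a) (sc s b); last first.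
  by exists (tick s); split; [apply: EWhF|exact: HQ H L].
have [s1 [E1 /IH [s2 [E2 H2]]]] := HS _ _ H L.
by exists s2; split=> //; apply: EWhT E1 E2.
Qed.

Lemma wp_mono c (Q Q' : st -> Prop) s :
  (forall s', Q s' -> Q' s') -> wp c Q s -> wp c Q' s.
Proof. by move=> H [s' [E /H]]; exists s'. Qed.

Definition asmod (a : atom) : seq nat :=
  match a with
  | AConst r _ | AAdd r _ _ | ASub r _ _ | ALoad r _ _ | ARead r => [:: r]
  | _ => [::]
  end.
Definition aamod (a : atom) : seq nat := if a is AStore k _ _ then [:: k] else [::].
Definition aio (a : atom) : bool :=
  match a with ARead _ | AWrite _ => true | _ => false end.

Fixpoint smod (c : cmd) : seq nat :=
  match c with
  | Block l => flatten (map asmod l)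
  | Seq c1 c2 | If _ _ c1 c2 => smod c1 ++ smod c2
  | While _ _ c => smod c
  end.
Fixpoint amod (c : cmd) : seq nat :=
  match c with
  | Block l => flatten (map aamod l)
  | Seq c1 c2 | If _ _ c1 c2 => amod c1 ++ amod c2
  | While _ _ c => amod c
  end.
Fixpoint cio (c : cmd) : bool :=
  match c with
  | Block l => has aio l
  | Seq c1 c2 | If _ _ c1 c2 => cio c1 || cio c2
  | While _ _ c => cio c
  end.

Definition frame (ss aa : seq nat) (io : bool) (s s' : st) : Prop :=
  [/\ forall v, v \notin ss -> sc s' v = sc s v,
      forall k, k \notin aa -> ar s' k = ar s k
    & ~~ io -> inp s' = inp s /\ out s' = out s].

Lemma frame_trans ss1 ss2 aa1 aa2 io1 io2 s s1 s2 :
  frame ss1 aa1 io1 s s1 -> frame ss2 aa2 io2 s1 s2 ->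
  frame (ss1 ++ ss2) (aa1 ++ aa2) (io1 || io2) s s2.
Proof.
case=> A1 A2 A3 [B1 B2 B3]; split.
- by move=> v; rewrite mem_cat => /norP[/A1 <- /B1].
- by move=> v; rewrite mem_cat => /norP[/A2 <- /B2].
by move=> /norP[/A3 [<- <-] /B3].
Qed.

Lemma frame_sub ss1 ss2 aa1 aa2 (io1 io2 : bool) s s' :
  {subset ss1 <= ss2} -> {subset aa1 <= aa2} -> (io1 -> io2) ->
  frame ss1 aa1 io1 s s' -> frame ss2 aa2 io2 s s'.
Proof.
move=> S1 S2 S3 [A1 A2 A3]; split.
- by move=> v H; apply: A1; apply: contra H; apply: S1.
- by move=> v H; apply: A2; apply: contra H; apply: S2.
by move=> H; apply: A3; apply: contra H.
Qed.

Lemma frame_aexec s a : frame (asmod a) (aamod a) (aio a) s (aexec s a).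
Proof.
case: a => [r k|r a b|r a b|r k i|k i r|r|r]; split=> //= v.
all: by rewrite inE /upd => /negbTE ->.
Qed.

Lemma exec_frame c s s' : exec c s s' -> frame (smod c) (amod c) (cio c) s s'.
Proof.
elim: c s s' / => [l s|c1 c2 s s1 s2 _ IH1 _ IH2|a b c1 c2 s s' _ _ IH
  |a b c1 c2 s s' _ _ IH|a b c s s1 s2 _ _ IH1 _ IH2|a b c s _] //=.
- elim: l s => [|a l IHl] s //=.
  exact: frame_trans (frame_aexec s a) (IHl _).
- exact: frame_trans IH1 IH2.
- by apply: frame_sub IH => [v H|v H|->] //; rewrite mem_cat H.
- by apply: frame_sub IH => [v H|v H|->] //; rewrite ?mem_cat ?H orbT.
- apply: frame_sub (frame_trans IH1 IH2) => [v|v|]; rewrite ?mem_cat; by case: orP => // -[].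
Qed.

(** Lets a specification mention only what changes; the rest follows by computation from the
    variables that the command can write. *)
Lemma wp_frame c Q s :
  wp c Q s -> wp c (fun s' => Q s' /\ frame (smod c) (amod c) (cio c) s s') s.
Proof. by case=> s' [E H]; exists s'; split=> //; split=> //; apply: exec_frame. Qed.

(** * Intersection of trapezoids *)

Section Geometry.
Import Order.TTheory GRing.Theory Num.Theory.

Definition trap_left (A B : trap) : bool := (tx2 A < tx1 B) && (ty2 A < ty1 B).
Definition trap_wf (A : trap) : bool := (tx1 A <= tx2 A) && (ty1 A <= ty2 A).

Lemma traps_intersectC A B : traps_intersect A B -> traps_intersect B A.
Proof. by case=> p [? ?]; exists p. Qed.

(** At a common point of height [s] the terms [(1 - s) * (a' - a)] and [s * (b' - b)] add up to 0,
    although both are nonnegative and one of them is positive. *)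
Lemma trap_left_disjoint A B : trap_left A B -> ~ traps_intersect A B.
Proof.
case/andP; rewrite -(ltr_nat rat) -(ltr_nat rat (ty2 A)) => Lx Ly.
case=> p [] [s [a [b [Hs Ha Hb ->]]]] [s' [a' [b' [_ Ha' Hb' []]]]].
move=> + Es; rewrite -Es => E.
have H1 : ((1 - s) * (a' - a) >= 0)%R by apply: mulr_ge0; lra.
have H2 : (s * (b' - b) >= 0)%R by apply: mulr_ge0; lra.
have [s0|s0] : (0 < s \/ 0 < 1 - s)%R by lra.
  have : (0 < s * (b' - b))%R by apply: mulr_gt0; lra.
  lra.
have : (0 < (1 - s) * (a' - a))%R by apply: mulr_gt0; lra.
lra.
Qed.

(* The left sides of the two trapezoids cross. *)
Lemma traps_intersect_cross A B : trap_wf A -> trap_wf B ->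
  tx2 A < tx1 B -> ty2 B < ty1 A -> traps_intersect A B.
Proof.
rewrite -(ltr_nat rat (tx2 A)) -(ltr_nat rat (ty2 B)) /trap_wf -!(ler_nat rat).
move=> /andP[Ax Ay] /andP[Bx By] Lx Ly.
pose d0 : rat := ((tx1 B)%:R - (tx1 A)%:R)%R.
pose d1 : rat := ((ty1 A)%:R - (ty1 B)%:R)%R.
have d0p : (0 < d0)%R by rewrite /d0; lra.
have d1p : (0 < d1)%R by rewrite /d1; lra.
have d01 : (0 < d0 + d1)%R by lra.
(* The height where the left sides meet: their gap goes linearly from [d0] at the bottom to [- d1]
   at the top. *)
pose s := (d0 / (d0 + d1))%R.
have s0 : (0 <= s <= 1)%R.
  by rewrite /s divr_ge0 /= ?ler_pdivrMr // ?mul1r; lra.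
exists ((1 - s) * (tx1 A)%:R + s * (ty1 A)%:R, s)%R; split.
  by exists s, (tx1 A)%:R%R, (ty1 A)%:R%R; split=> //; rewrite lexx.
exists s, (tx1 B)%:R%R, (ty1 B)%:R%R; split; rewrite ?lexx //.
congr (_, _); rewrite /s /d0 /d1; field.
by move: d01; rewrite /d0 /d1; lra.
Qed.

Lemma traps_intersect_bottom A B : trap_wf A -> trap_wf B ->
  tx1 A <= tx2 B -> tx1 B <= tx2 A -> traps_intersect A B.
Proof.
case/andP=> Ax Ay /andP[Bx By] L1 L2.
exists ((maxn (tx1 A) (tx1 B))%:R, 0)%R; split.
  exists 0%R, (maxn (tx1 A) (tx1 B))%:R%R, (ty1 A)%:R%R.
  by split; rewrite ?ler_nat ?lexx //; [lia|lia|congr (_, _); ring].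
exists 0%R, (maxn (tx1 A) (tx1 B))%:R%R, (ty1 B)%:R%R.
by split; rewrite ?ler_nat ?lexx //; [lia|lia|congr (_, _); ring].
Qed.

Lemma traps_intersect_top A B : trap_wf A -> trap_wf B ->
  ty1 A <= ty2 B -> ty1 B <= ty2 A -> traps_intersect A B.
Proof.
case/andP=> Ax Ay /andP[Bx By] L1 L2.
exists ((maxn (ty1 A) (ty1 B))%:R, 1)%R; split.
  exists 1%R, (tx1 A)%:R%R, (maxn (ty1 A) (ty1 B))%:R%R.
  by split; rewrite ?ler_nat ?lexx //; [lia|lia|congr (_, _); ring].
exists 1%R, (tx1 B)%:R%R, (maxn (ty1 A) (ty1 B))%:R%R.
by split; rewrite ?ler_nat ?lexx //; [lia|lia|congr (_, _); ring].
Qed.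

(** Overlapping intervals on either line share a point. If both pairs are disjoint, neither
    trapezoid being left of the other means that the orders on the two lines are opposite, and the
    left sides cross. *)
Lemma traps_intersectP A B : trap_wf A -> trap_wf B ->
  (traps_intersect A B <-> ~~ trap_left A B && ~~ trap_left B A).
Proof.
move=> wA wB; split=> [I|].
  apply/andP; split; apply/negP => /trap_left_disjoint; apply=> //.
  exact: traps_intersectC.
have [Lx|Lx] := ltnP (tx2 A) (tx1 B).
  rewrite /trap_left Lx /= -leqNgt => /andP[Ly _].
  have [Lz|Lz] := ltnP (ty2 B) (ty1 A); first exact: traps_intersect_cross.
  exact: traps_intersect_top.
have [Lz|Lz] := ltnP (tx2 B) (tx1 A).
  rewrite /trap_left Lz /= -leqNgt => /andP[_ Ly].
  have [Lw|Lw] := ltnP (ty2 A) (ty1 B).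
    exact/traps_intersectC/traps_intersect_cross.
  exact: traps_intersect_top.
by move=> _; apply: traps_intersect_bottom.
Qed.

End Geometry.

(** * Chains of edges and the dynamic program *)

(** What the sweep uses of a model, the trapezoids being numbered from 0. By [x_onto] each abscissa
    that is swept has an owner. *)
Record coords (n : nat) (x1 x2 y1 y2 : nat -> nat) : Prop := Coords {
  x12 : forall i, i < n -> x1 i < x2 i;
  y12 : forall i, i < n -> y1 i < y2 i;
  x_range : forall i, i < n -> 0 < x1 i /\ x2 i <= 2 * n;
  x_onto : forall p, 0 < p <= 2 * n -> exists2 i, i < n & p = x1 i \/ p = x2 i;
  x1_inj : forall i j, i < n -> j < n -> x1 i = x1 j -> i = j;
  x2_inj : forall i j, i < n -> j < n -> x2 i = x2 j -> i = j;
  x1_x2 : forall i j, i < n -> j < n -> x1 i <> x2 j;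
  y2_inj : forall i j, i < n -> j < n -> y2 i = y2 j -> i = j
}.

(* [tbl v] is the least top-right corner of a chain of [v] edges found so far,
   [lev] the largest such [v], and [(wa v, wb v)] the last edge of that chain.
   For a trapezoid [i], [fl i], [ft i] and [(pa i, pb i)] are the level of the
   best chain to the left of [i], and the corner and the last edge of it. *)
Record dps := Dps {
  lev : nat; tbl : nat -> nat; wa : nat -> nat; wb : nat -> nat;
  fl : nat -> nat; ft : nat -> nat; pa : nat -> nat; pb : nat -> nat }.

(** The edge before [(a, b)] is the one frozen for [a], whatever [b] is, so pointers are stored per
    trapezoid and not per edge. *)
Fixpoint trace (PA PB : nat -> nat) (v a b : nat) : seq (nat * nat) :=
  if v is v'.+1 then (a, b) :: trace PA PB v' (PA a) (PB a) else [::].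

Lemma size_trace PA PB v a b : size (trace PA PB v a b) = v.
Proof. by elim: v a b => //= v IH a b; rewrite IH. Qed.

Lemma trace_upd PA PB v a b i r r' :
  i \notin map fst (trace PA PB v a b) ->
  trace (upd PA i r) (upd PB i r') v a b = trace PA PB v a b.
Proof.
elim: v a b => //= v IH a b; rewrite inE negb_or => /andP[Hi Hm].
have E : (a == i) = false by apply/negbTE; rewrite eq_sym.
by rewrite /upd E IH.
Qed.

Section Chains.
Variables (n : nat) (x1 x2 y1 y2 : nat -> nat).
Hypothesis cs : coords n x1 x2 y1 y2.

(** The second comparison is weak to match the negated tests of the program; in a model it agrees
    with the strict one because upper coordinates are distinct. *)
Definition lft i j := (x2 i < x1 j) && (y2 i <= y1 j).
Definition adj i j := ~~ lft i j && ~~ lft j i.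
Definition deg i := count (fun j => (j != i) && adj i j) (iota 0 n).

(* An edge is represented with the trapezoid of smaller [x1] first. *)
Definition edge (e : nat * nat) :=
  [&& e.1 < n, e.2 < n, x1 e.1 < x1 e.2 & adj e.1 e.2].
Definition srt i j := if x1 i < x1 j then (i, j) else (j, i).

Definition bx2 (e : nat * nat) := maxn (x2 e.1) (x2 e.2).
Definition by1 (e : nat * nat) := minn (y1 e.1) (y1 e.2).
Definition by2 (e : nat * nat) := maxn (y2 e.1) (y2 e.2).
(** By the orientation of edges, [x1 f.1] is the left end of the box of [f]. *)
Definition bef e f := (bx2 e < x1 f.1) && (by2 e <= by1 f).

(* The rightmost edge of a chain comes first. *)
Definition chain (c : seq (nat * nat)) :=
  all edge c && sorted (fun f e => bef e f) c.

Lemma adjC i j : adj i j = adj j i.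
Proof. by rewrite /adj andbC. Qed.

Lemma edge_srt i j : i < n -> j < n -> i != j -> adj i j -> edge (srt i j).
Proof.
move=> Hi Hj /eqP ij a; rewrite /srt; case: ifP => L; rewrite /edge /=.
  by rewrite Hi Hj L a.
rewrite Hi Hj adjC a /= andbT; case: ltngtP L => // E _.
by case: ij; apply: (x1_inj cs).
Qed.

Lemma bx2_srt i j : bx2 (srt i j) = maxn (x2 i) (x2 j).
Proof. by rewrite /srt /bx2; case: ifP => //= _; rewrite maxnC. Qed.

Lemma edge_box e : edge e -> x1 e.1 < bx2 e /\ by1 e < by2 e.
Proof.
case/and4P=> H1 H2 _ _; have [? ?] := (x12 cs H1, y12 cs H1).
by rewrite /bx2 /by2 /by1; lia.
Qed.

Lemma bef_trans e f g : edge f -> bef e f -> bef f g -> bef e g.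
Proof.
by move=> /edge_box[? ?] /andP[? ?] /andP[? ?]; rewrite /bef; apply/andP; lia.
Qed.

Lemma chain1 e : chain [:: e] = edge e.
Proof. by rewrite /chain /= !andbT. Qed.

Lemma chain_cons2 f e c : chain [:: f, e & c] = [&& edge f, bef e f & chain (e :: c)].
Proof. by rewrite /chain /=; case: (edge f) => //=; case: (bef e f); rewrite ?andbF. Qed.

Lemma chain_cons f c : chain (f :: c) ->
  [/\ edge f, chain c & if c is e :: _ then bef e f else true].
Proof.
case: c => [|e c]; first by rewrite chain1 => ->; split.
by rewrite chain_cons2 => /and3P[].
Qed.

Lemma chain_drop i c : chain c -> chain (drop i c).
Proof.
elim: i c => [|i IH] [|f c] //=.
by case/chain_cons=> _ /IH.
Qed.

Lemma chain_bef f c e : chain (f :: c) -> e \in c -> bef e f.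
Proof.
elim: c f => [|g c IH] f //; rewrite chain_cons2 => /and3P[ef gf ch].
rewrite inE => /predU1P[-> //|ec].
apply: bef_trans gf; last exact: IH ec.
by case/andP: ch => /andP[].
Qed.

Lemma chain_edge c e : chain c -> e \in c -> edge e.
Proof. by case/andP=> /allP H _ /H. Qed.

Lemma chain_by2 f c e : chain (f :: c) -> e \in f :: c -> by2 e <= by2 f.
Proof.
move=> ch; rewrite inE => /predU1P[-> //|ec].
have /andP[_ B] := chain_bef ch ec.
by have [ef _ _] := chain_cons ch; have [_] := edge_box ef; lia.
Qed.

Lemma chain_bx2 f c e : chain (f :: c) -> e \in f :: c -> bx2 e <= bx2 f.
Proof.
move=> ch; rewrite inE => /predU1P[-> //|ec].
have /andP[B _] := chain_bef ch ec.
by have [ef _ _] := chain_cons ch; have [] := edge_box ef; lia.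
Qed.

(** A representative vertex of an edge, used for counting: it reaches the upper right corner of the
    box, and these corners increase strictly along a chain. *)
Definition top (e : nat * nat) := if y2 e.1 < y2 e.2 then e.2 else e.1.

Lemma y2_top e : y2 (top e) = by2 e.
Proof. by rewrite /top /by2; case: ltnP; lia. Qed.

Lemma x2_top e : x2 (top e) <= bx2 e.
Proof. by rewrite /top /bx2; case: ltnP; lia. Qed.

Lemma top_lt e : edge e -> top e < n.
Proof. by rewrite /top => /and4P[? ? _ _]; case: ifP. Qed.

Lemma chain_top_uniq c : chain c -> uniq (map top c).
Proof.
elim: c => [|f c IH] //= ch; have [ef cc _] := chain_cons ch.
rewrite IH // andbT; apply/mapP => -[e ec /(congr1 y2)].
rewrite !y2_top => E; have /andP[_] := chain_bef ch ec.
by have [_] := edge_box ef; lia.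
Qed.

Lemma size_chain c : chain c -> size c <= n.
Proof.
move=> ch; rewrite -(size_iota 0 n) -(size_map top).
apply: uniq_leq_size; first exact: chain_top_uniq.
move=> _ /mapP[e ec ->]; rewrite mem_iota /= add0n.
exact/top_lt/(chain_edge ch).
Qed.

Lemma deg_ge i s : uniq s ->
  {in s, forall j, [/\ j < n, j != i & adj i j]} -> size s <= deg i.
Proof.
move=> us H; rewrite /deg -size_filter; apply: uniq_leq_size => // j js.
by have [jn ji a] := H j js; rewrite mem_filter ji a mem_iota.
Qed.

(** Every abscissa strictly inside the lower interval of [i] belongs to a neighbour, and a neighbour
    has only two abscissas. *)
Lemma deg_width i : i < n -> x2 i - x1 i <= 2 * deg i + 1.
Proof.
move=> Hi; pose s := filter (fun j => (j != i) && adj i j) (iota 0 n).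
have Es : size s = deg i by rewrite size_filter.
suff : size (iota (x1 i).+1 (x2 i - x1 i).-1) <= size (map x1 s ++ map x2 s).
  by rewrite size_iota size_cat !size_map Es; lia.
apply: uniq_leq_size; first exact: iota_uniq.
move=> p; rewrite mem_iota => Hp.
have Lp : 0 < p <= 2 * n by have := x_range cs Hi; lia.
have [j Hj E] := x_onto cs Lp.
have ji : j != i by apply/eqP => ji; move: E; rewrite ji; lia.
have js : j \in s.
  rewrite mem_filter mem_iota ji /= Hj andbT /adj /lft.
  by have := x12 cs Hj; have := x12 cs Hi; case: E; lia.
by rewrite mem_cat; case: E => ->; rewrite map_f ?orbT.
Qed.

(** * The invariant of the dynamic program and its preservation *)

Definition reached (d : dps) (k y : nat) := (k <= lev d) && (tbl d k <= y).

(* Everything that ends at abscissas smaller than [x] has been taken into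
   account; the chains in the table end at abscissas smaller than [z]. *)
Record dp (x z : nat) (d : dps) : Prop := Dp {
  dp_tbl0 : tbl d 0 = 0;
  dp_sound : forall v, 0 < v <= lev d ->
    [/\ chain (trace (pa d) (pb d) v (wa d v) (wb d v)),
        bx2 (wa d v, wb d v) < z & by2 (wa d v, wb d v) = tbl d v];
  dp_complete : forall e c, chain (e :: c) -> bx2 e < x ->
    reached d (size c).+1 (by2 e);
  dp_vertex : forall i, i < n -> x1 i < x ->
    [/\ ft d i <= y1 i,
        fl d i = 0 -> ft d i = 0,
        0 < fl d i ->
          [/\ chain (trace (pa d) (pb d) (fl d i) (pa d i) (pb d i)),
              bx2 (pa d i, pb d i) < x1 i & by2 (pa d i, pb d i) = ft d i]
      & forall e c, chain (e :: c) -> bx2 e < x1 i -> by2 e <= y1 i ->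
          (size c).+1 <= fl d i /\ (fl d i = (size c).+1 -> ft d i <= by2 e)]
}.

(** Opens the turn of a right end [x]: its edges come one by one, so the table may hold chains
    ending at [x] while completeness is known only before [x]. *)
Lemma dp_weaken x d : dp x x d -> dp x x.+1 d.
Proof.
by case=> T0 S C V; split=> // v /S[? B ?]; split=> //; apply: ltnW.
Qed.

Definition set_vertex (d : dps) (i v : nat) : dps :=
  Dps (lev d) (tbl d) (wa d) (wb d) (upd (fl d) i v) (upd (ft d) i (tbl d v))
      (upd (pa d) i (wa d v)) (upd (pb d) i (wb d v)).

(** An edge with first end [i] ends after [x1 i], so a chain that ends by then never follows the
    pointers of [i]. *)
Lemma trace_early d i v a b r r' : chain (trace (pa d) (pb d) v a b) ->
  bx2 (a, b) <= x1 i ->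
  trace (upd (pa d) i r) (upd (pb d) i r') v a b = trace (pa d) (pb d) v a b.
Proof.
case: v => // v ch B; apply: trace_upd; apply/mapP => -[e ec E].
have := chain_bx2 ch ec; have [] := edge_box (chain_edge ch ec).
by move: B; rewrite E /=; lia.
Qed.

Lemma dp_set_vertex x d i v : dp x x d -> i < n -> x1 i = x -> v <= lev d ->
  tbl d v <= y1 i -> (forall w, v < w <= lev d -> y1 i < tbl d w) ->
  dp x.+1 x.+1 (set_vertex d i v).
Proof.
case=> T0 S C V Hi Ex Lv Tv Tw; split=> //=.
- move=> w /S[Ch B E]; split=> //; last exact: ltnW.
  by rewrite trace_early // Ex ltnW.
(* The abscissa [x] is a left end, so no edge ends there. *)
- move=> e c ch; rewrite ltnS leq_eqVlt => /predU1P[E|]; last exact: C.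
  have /chain_cons[/and4P[H1 H2 _ _] _ _] := ch.
  by have := x1_x2 cs Hi H1; have := x1_x2 cs Hi H2; move: E; rewrite /bx2; lia.
move=> j Hj Lj; rewrite /upd; case: eqVneq => [->|ji].
  split=> //; first by move=> ->.
    move=> v0; have /S[Ch B E] : 0 < v <= lev d by rewrite v0.
    by rewrite Ex; split=> //; rewrite -/(upd _ _ _) trace_early // Ex ltnW.
  (* The level of a chain to the left of [i] has an entry at most [y1 i], hence cannot exceed
     [v]. *)
  move=> e c ch; rewrite Ex => /(C _ _ ch) /andP[Lc Tc] Le.
  suff Lv' : (size c).+1 <= v by split=> // ->.
  by rewrite leqNgt; apply/negP => L; have := Tw (size c).+1; lia.
have {}Lj : x1 j < x.
  have : x1 j <> x1 i by move/(x1_inj cs Hj Hi) => E; rewrite E eqxx in ji.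
  by lia.
have [V1 V2 V3 V4] := V j Hj Lj; split=> // /V3[Ch B E]; split=> //.
by rewrite -!/(upd _ _ _) trace_early //; lia.
Qed.

(** Completeness for the chains that end with [e]; it is gathered edge by edge during the turn of a
    right end. *)
Definition covered (d : dps) (e : nat * nat) : Prop :=
  forall c, chain (e :: c) -> reached d (size c).+1 (by2 e).

(** The chain frozen for [e.1] lies to the left of [e.1], so only the upper left corner of [e.2] has
    to be compared with it. *)
Definition improves (d : dps) (e : nat * nat) : bool :=
  let w := (fl d e.1).+1 in
  (ft d e.1 <= y1 e.2) && ((lev d < w) || (by2 e < tbl d w)).

Definition set_edge (d : dps) (e : nat * nat) : dps :=
  let w := (fl d e.1).+1 in
  Dps (maxn (lev d) w) (upd (tbl d) w (by2 e)) (upd (wa d) w e.1)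
      (upd (wb d) w e.2) (fl d) (ft d) (pa d) (pb d).

Definition process (d : dps) (e : nat * nat) : dps :=
  if improves d e then set_edge d e else d.

Lemma lev_fl x z d i : dp x z d -> i < n -> x1 i < x -> fl d i <= lev d.
Proof.
case=> _ _ C V Hi Lx; have [_ _ V3 _] := V i Hi Lx.
case E : (fl d i) V3 => [|v] // /(_ isT) [] Ch B _.
have /andP[] := C _ _ Ch (ltn_trans B Lx).
by rewrite size_trace.
Qed.

Lemma reached_process x z d e k y : dp x z d -> e.1 < n -> x1 e.1 < x ->
  reached d k y -> reached (process d e) k y.
Proof.
move=> D Hn Hx; rewrite /process; case: ifP => // /andP[_ I].
have Lf := lev_fl D Hn Hx.
rewrite /reached /= /upd => /andP[Lk Tk]; apply/andP; split; first by lia.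
by case: eqP => // Ek; move: I Tk; rewrite Ek; lia.
Qed.

(* If the level of [e.1] exceeds the length of [c], then already a part of the
   chain recorded for [e.1] is long enough and ends below [e]. *)
Lemma process_covered x d e : dp x x.+1 d -> bx2 e = x ->
  covered (process d e) e.
Proof.
move=> D Ex c ch; have [ed cc hc] := chain_cons ch.
have [H1 H2 L12 _] := and4P ed.
have [Lx Ly] := edge_box ed; rewrite Ex in Lx.
have [V1 V2 V3 V4] := dp_vertex D H1 Lx.
have Lf := lev_fl D H1 Lx.
have [Lc|Lc] := ltnP (size c) (fl d e.1).
  apply: (reached_process D H1 Lx).
  have f0 : 0 < fl d e.1 by lia.
  have [Ch B E] := V3 f0; set t := trace _ _ _ _ _ in Ch.
  have st : size t = fl d e.1 by rewrite size_trace.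
  have t0 : t = (pa d e.1, pb d e.1) :: behead t.
    by rewrite /t; case: (fl d e.1) f0.
  (* The leftmost [(size c).+1] edges of the chain frozen for [e.1] end before [x], hence are in the
     table, with a corner at most [y1 e.1]. *)
  have := chain_drop (size t - (size c).+1) Ch.
  have := size_drop (size t - (size c).+1) t.
  case Ed : (drop _ t) => [|g c'] /= Sd Cd; first by lia.
  have gt : g \in t by apply: (mem_drop (n0 := size t - (size c).+1)); rewrite Ed mem_head.
  rewrite t0 in gt Ch.
  have Bg := chain_bx2 Ch gt; have Yg := chain_by2 Ch gt.
  have : bx2 g < x by lia.
  move/(dp_complete D Cd); have -> : (size c').+1 = (size c).+1 by lia.
  case/andP=> Lk Tk; rewrite /reached Lk /=.
  have := y12 cs H1; move: Yg Tk V1; rewrite E /by2; lia.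
have [Ef Le] : fl d e.1 = size c /\ ft d e.1 <= y1 e.2.
  case: c cc hc Lc {ch} => [|g c] cc hc /= Lc.
    have F0 : fl d e.1 = 0 by lia.
    by rewrite F0 V2.
  have /andP[B1 B2] := hc; rewrite /by1 leq_min in B2.
  have [B2' B3] := andP B2.
  have [/= V5 V6] := V4 _ _ cc B1 B2'.
  have Ef : fl d e.1 = (size c).+1 by move: Lc => /=; lia.
  by split=> //; apply: leq_trans (V6 Ef) B3.
rewrite /process /improves Le Ef /=; case: ifP => [_|/negbT].
  by rewrite /reached /= Ef /upd eqxx leq_maxr leqnn.
by rewrite /reached; lia.
Qed.

(** The new trace is [e] followed by the chain frozen for [e.1]. The pointers do not change, so
    neither do the traces at other levels. *)
Lemma dp_process x d e : dp x x.+1 d -> edge e -> bx2 e = x ->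
  dp x x.+1 (process d e).
Proof.
move=> D ed Ex; have [H1 H2 L12 _] := and4P ed.
have [Lx Ly] := edge_box ed; rewrite Ex in Lx.
have [V1 V2 V3 V4] := dp_vertex D H1 Lx.
have Lf := lev_fl D H1 Lx.
have R k y := @reached_process _ _ _ e k y D H1 Lx.
move: R; rewrite /process; case: ifP => // I R; case: D => T0 S C V; split=> //=.
- move=> v; rewrite /upd; case: eqP => [->|Nv] Lv; last by apply: S; lia.
  rewrite -surjective_pairing Ex; split=> //.
  case Ef : (fl d e.1) V3 => [|v'] V3 /=; first by rewrite chain1 -surjective_pairing.
  have [//|Ch B E] := V3; rewrite chain_cons2 -surjective_pairing ed Ch andbT.
  move/andP: I => [I _]; rewrite /bef B E /by1.
  by move: V1 I; rewrite /= leq_min => -> ->.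
by move=> e' c ch L; apply/R/C.
Qed.

Lemma dp_step x d i j : dp x x.+1 d -> i < n -> j < n -> x2 i = x ->
  x2 j < x -> adj i j ->
  [/\ dp x x.+1 (process d (srt i j)), covered (process d (srt i j)) (srt i j)
    & forall e, covered d e -> covered (process d (srt i j)) e].
Proof.
move=> D Hi Hj Ex Lx a; have ij : i != j by apply/eqP => E; move: Lx; rewrite -E Ex ltnn.
have ed := edge_srt Hi Hj ij a.
have Eb : bx2 (srt i j) = x by rewrite bx2_srt; lia.
split; first exact: dp_process D ed Eb.
  exact: process_covered D Eb.
move=> e C c ch.
have [H1 _ _ _] := and4P ed; have [Le _] := edge_box ed; rewrite Eb in Le.
exact: (reached_process D H1 Le (C c ch)).
Qed.

(** An edge ending at [x] joins [i] to a neighbour with a smaller right end, and no trapezoid begins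
    at [x]. *)
Lemma dp_close x d i : dp x x.+1 d -> i < n -> x2 i = x ->
  (forall j, j < n -> x2 j < x -> adj i j -> covered d (srt i j)) ->
  dp x.+1 x.+1 d.
Proof.
case=> T0 S C V Hi Ex R; split=> //.
  move=> e c ch; rewrite ltnS leq_eqVlt => /predU1P[E|]; last exact: C.
  have [ed _ _] := chain_cons ch; have [H1 H2 L12 a] := and4P ed.
  case: e => a1 a2 /= in ch E H1 H2 L12 a ed *; rewrite /bx2 /= in E.
  have [L|L] := ltnP (x2 a1) (x2 a2).
    have Ei : a2 = i by apply: (x2_inj cs) => //; lia.
    have Es : srt i a1 = (a1, a2) by rewrite /srt -Ei ltnNge (ltnW L12).
    by have := R a1 H1; rewrite Es -Ei adjC; apply=> //; lia.
  have Ei : a1 = i by apply: (x2_inj cs) => //; lia.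
  have Nx : x2 a2 <> x2 a1 by move/(x2_inj cs H2 H1) => N; rewrite N ltnn in L12.
  have Es : srt i a2 = (a1, a2) by rewrite /srt -Ei L12.
  by have := R a2 H2; rewrite Es -Ei; apply=> //; lia.
move=> j Hj; rewrite ltnS leq_eqVlt => /predU1P[E|]; last exact: V.
by case: (x1_x2 cs Hj Hi); rewrite E Ex.
Qed.

(** Take the last [lev d - v] edges of the longest chain. Each of them ends a chain of more than [v]
    edges, so its corner is at least a table entry above [y1 i]. Its [top] ends before [x1 i] below
    and after [y1 i] above, hence is a neighbour of [i]. *)
Lemma dp_walk x d i v : dp x x d -> i < n -> x1 i = x ->
  (forall w, v < w <= lev d -> y1 i < tbl d w) -> lev d - v <= deg i.
Proof.
move=> D Hi Ex Tw; have [|Lv] := leqP (lev d) v; first by lia.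
have /(dp_sound D)[] : 0 < lev d <= lev d by lia.
set t := trace _ _ _ _ _ => Ch B E.
have st : size t = lev d by rewrite size_trace.
have t0 : t = (wa d (lev d), wb d (lev d)) :: behead t.
  by rewrite /t; case: (lev d) Lv.
have <- : size (map top (take (lev d - v) t)) = lev d - v.
  by rewrite size_map size_takel // st leq_subr.
apply: deg_ge; first by rewrite map_take take_uniq // chain_top_uniq.
move=> _ /mapP[e /(nthP (0, 0)) [k Hk <-] ->]; set g := nth _ _ _.
move: Hk; rewrite size_takel ?st ?leq_subr // => Hk.
have Eg : g = nth (0, 0) t k by rewrite /g nth_take.
have kt : k < size t by lia.
have gt : g \in t by rewrite Eg mem_nth.
have Dk := drop_nth (0, 0) kt; rewrite -Eg in Dk.
have := chain_drop k Ch; rewrite Dk => Cg.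
have Bg : bx2 g < x by move: gt Ch; rewrite t0 => gt /chain_bx2 /(_ gt); lia.
have /andP[_] := dp_complete D Cg Bg.
have -> : (size (drop k.+1 t)).+1 = lev d - k by rewrite size_drop; lia.
have := Tw (lev d - k); have := y2_top g; have := x2_top g => ? ? ? ?.
have Hg := top_lt (chain_edge Ch gt).
have ? := x12 cs Hg; have ? := x12 cs Hi.
split=> //; first by apply/eqP => Et; have := x2_top g; have := x12 cs Hi; rewrite Et; lia.
by rewrite /adj /lft; lia.
Qed.

End Chains.

Lemma dp_init n x1 x2 y1 y2 d : coords n x1 x2 y1 y2 ->
  lev d = 0 -> tbl d 0 = 0 -> dp n x1 x2 y1 y2 1 1 d.
Proof.
move=> cs L0 T0; split=> // [v|e c ch|i Hi]; first by rewrite L0; lia.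
  have [/and4P[H1 _ _ _] _ _] := chain_cons ch.
  by have := x12 cs H1; rewrite /bx2; lia.
by have := x_range cs Hi; lia.
Qed.

(** Each trapezoid owns exactly two abscissas; this turns the cost of the sweep into a sum of
    degrees. *)
Lemma sum_own n x1 x2 y1 y2 (own g : nat -> nat) : coords n x1 x2 y1 y2 ->
  (forall i, i < n -> own (x1 i) = i /\ own (x2 i) = i) ->
  \sum_(p <- iota 1 (2 * n)) g (own p) = 2 * \sum_(i <- iota 0 n) g i.
Proof.
move=> cs Ho; have Hi i : i \in iota 0 n = (i < n) by rewrite mem_iota.
rewrite (perm_big (map x1 (iota 0 n) ++ map x2 (iota 0 n))) /=; last first.
  apply: uniq_perm => [||p]; first exact: iota_uniq.
    rewrite cat_uniq !map_inj_in_uniq ?iota_uniq /=.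
    - rewrite andbT; apply/hasPn => _ /mapP[j jn ->]; apply/mapP => -[i iN].
      by move=> /esym; apply: (x1_x2 cs); rewrite -Hi.
    - by move=> i j; rewrite !Hi; apply: (x2_inj cs).
    - by move=> i j; rewrite !Hi; apply: (x1_inj cs).
  rewrite mem_iota mem_cat; apply/idP/orP => [Lp|].
    have [|i iN [->|->]] := x_onto cs (p := p); first by lia.
      by left; rewrite map_f // Hi.
    by right; rewrite map_f // Hi.
  by case=> /mapP[i]; rewrite Hi => iN ->;
    have := x_range cs iN; have := x12 cs iN; lia.
rewrite big_cat !big_map mul2n -addnn; congr (_ + _);
  by apply: eq_big_seq => i; rewrite Hi => /Ho[E1 E2]; rewrite ?E1 ?E2.
Qed.

(** * Induced matchings of a model as chains of edges *)

Section Model.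
Variable tau : seq trap.
Hypothesis Ht : trapezoid_model tau.

Definition cx1 i := tx1 (nth (Trap 0 0 0 0) tau i).
Definition cx2 i := tx2 (nth (Trap 0 0 0 0) tau i).
Definition cy1 i := ty1 (nth (Trap 0 0 0 0) tau i).
Definition cy2 i := ty2 (nth (Trap 0 0 0 0) tau i).
Local Notation n := (size tau).
Local Notation adj := (adj cx1 cx2 cy1 cy2).
Local Notation deg := (deg n cx1 cx2 cy1 cy2).
Local Notation edge := (edge n cx1 cx2 cy1 cy2).
Local Notation chain := (chain n cx1 cx2 cy1 cy2).
Local Notation lft := (lft cx1 cx2 cy1 cy2).
Local Notation srt := (srt cx1).

Lemma size_pairs (f g : trap -> nat) (s : seq trap) :
  size (flatten [seq [:: f A; g A] | A <- s]) = (size s).*2.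
Proof. by elim: s => //= A s ->. Qed.

Lemma nth_pairs (f g : trap -> nat) (s : seq trap) A0 i : i < size s ->
  nth 0 (flatten [seq [:: f A; g A] | A <- s]) i.*2 = f (nth A0 s i) /\
  nth 0 (flatten [seq [:: f A; g A] | A <- s]) i.*2.+1 = g (nth A0 s i).
Proof. by elim: s i => [|A s IH] [|i] //= /IH. Qed.

Lemma pairs_uniq (f g : trap -> nat) (s : seq trap) A0 i j :
  uniq (flatten [seq [:: f A; g A] | A <- s]) -> i < size s -> j < size s ->
  [/\ f (nth A0 s i) = f (nth A0 s j) -> i = j,
      g (nth A0 s i) = g (nth A0 s j) -> i = j
    & f (nth A0 s i) <> g (nth A0 s j)].
Proof.
move=> U Hi Hj; have [<- <-] := nth_pairs f g A0 Hi; have [<- <-] := nth_pairs f g A0 Hj.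
by split=> /eqP; rewrite nth_uniq ?size_pairs; lia.
Qed.

Lemma pairs_mem (f g : trap -> nat) (s : seq trap) A0 p :
  reflect (exists2 i, i < size s & p = f (nth A0 s i) \/ p = g (nth A0 s i))
          (p \in flatten [seq [:: f A; g A] | A <- s]).
Proof.
elim: s => [|A s IH] /=; first by constructor; case.
rewrite !inE orbA; apply: (iffP orP) => [[Ep|/IH[i Hi Ep]]|[[|i] Hi Ep]].
- by exists 0 => //=; case/orP: Ep => /eqP; auto.
- by exists i.+1.
- by left; case: Ep => /= ->; rewrite eqxx ?orbT.
- by right; apply/IH; exists i.
Qed.

Lemma model_coords : coords n cx1 cx2 cy1 cy2.
Proof.
case: Ht => /(all_nthP (Trap 0 0 0 0)) Hx /(all_nthP (Trap 0 0 0 0)) Hy Ux Uy [/allP Rx _].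
have Wx i : i < n -> cx1 i <= cx2 i by apply: Hx.
have Wy i : i < n -> cy1 i <= cy2 i by apply: Hy.
have Px i j (Hi : i < n) (Hj : j < n) := pairs_uniq (Trap 0 0 0 0) Ux Hi Hj.
have Py i j (Hi : i < n) (Hj : j < n) := pairs_uniq (Trap 0 0 0 0) Uy Hi Hj.
split=> [i Hi|i Hi|i Hi|p Hp|i j Hi Hj|i j Hi Hj|i j Hi Hj|i j Hi Hj].
- by have [_ _ /eqP] := Px i i Hi Hi; have := Wx i Hi; rewrite /cx1 /cx2; lia.
- by have [_ _ /eqP] := Py i i Hi Hi; have := Wy i Hi; rewrite /cy1 /cy2; lia.
- have /Rx M1 : cx1 i \in xcoords tau by apply/(pairs_mem tx1 tx2 _ (Trap 0 0 0 0)); eauto.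
  have /Rx M2 : cx2 i \in xcoords tau by apply/(pairs_mem tx1 tx2 _ (Trap 0 0 0 0)); eauto.
  by lia.
(* There are [2 * n] distinct abscissas between 1 and [2 * n], so they fill this range. *)
- have S : {subset xcoords tau <= iota 1 (2 * n)}.
    by move=> q /Rx; rewrite mem_iota; lia.
  have [|_ E] := uniq_min_size Ux S.
    by rewrite size_iota size_pairs mul2n.
  have : p \in xcoords tau by rewrite E mem_iota; lia.
  by move/(pairs_mem tx1 tx2 _ (Trap 0 0 0 0)).
- by have [] := Px i j Hi Hj.
- by have [] := Px i j Hi Hj.
- by have [] := Px i j Hi Hj.
- by have [] := Py i j Hi Hj.
Qed.

Let cs := model_coords.

Lemma tg_adjP i j : tg_adj tau i j <-> [&& i < n, j < n, i != j & adj i j].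
Proof.
have [/(all_nthP (Trap 0 0 0 0)) Hx /(all_nthP (Trap 0 0 0 0)) Hy _ Uy _] := Ht.
have W k : k < n -> trap_wf (nth (Trap 0 0 0 0) tau k).
  by move=> Hk; rewrite /trap_wf Hx ?Hy.
have E k l : k < n -> l < n ->
    trap_left (nth (Trap 0 0 0 0) tau k) (nth (Trap 0 0 0 0) tau l) = lft k l.
  move=> Hk Hl; rewrite /trap_left /lft; congr (_ && _); rewrite ltn_neqAle.
  have [_ _ N] := pairs_uniq (Trap 0 0 0 0) Uy Hl Hk.
  by case: eqP => // E; case: N.
split=> [[Hi Hj ij]|/and4P[Hi Hj ij]].
  by move/(traps_intersectP (W _ Hi) (W _ Hj)); rewrite !E // Hi Hj ij.
by move=> a; split=> //; apply/(traps_intersectP (W _ Hi) (W _ Hj)); rewrite !E.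
Qed.

(** Half of the handshake lemma: the ordered adjacent pairs all occur in the list of edges or in its
    reversal. *)
Lemma sum_deg m : num_edges tau m -> \sum_(i <- iota 0 n) deg i <= 2 * m.
Proof.
case=> E [_ HE <-].
pose nb i := filter (fun j => (j != i) && adj i j) (iota 0 n).
pose L := [seq (i, j) | i <- iota 0 n, j <- nb i].
have -> : \sum_(i <- iota 0 n) deg i = size L.
  rewrite size_allpairs_dep sumnE big_map.
  by apply: eq_bigr => i _; rewrite size_filter.
have -> : 2 * size E = size (E ++ map (fun p => (p.2, p.1)) E).
  by rewrite size_cat size_map mul2n addnn.
apply: uniq_leq_size.
  apply: allpairs_uniq_dep => [|i _|]; rewrite ?filter_uniq ?iota_uniq //.
  by move=> [i j] [k l] _ _ [-> ->].
move=> _ /allpairsPdep[i [j [Hi Hj ->]]].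
move: Hi Hj; rewrite mem_filter !mem_iota /= => Hi /andP[/andP[ij a] Hj].
rewrite mem_cat; apply/orP; have [L1|L1] := ltnP i j.
  by left; apply/HE; split=> //; apply/tg_adjP; rewrite Hi Hj eq_sym ij.
right; apply/mapP; exists (j, i) => //; apply/HE; split=> /=; first by lia.
by apply/tg_adjP; rewrite Hi Hj ij adjC.
Qed.

Lemma unord_srt e : unord (srt e.1 e.2) = unord e.
Proof. by rewrite /srt; case: ifP => // _; rewrite /unord /= minnC maxnC. Qed.

Lemma unord_inj e f : unord e = unord f -> f = e \/ f = (e.2, e.1).
Proof.
case: e f => a b [c d] /= [E1 E2]; rewrite /= in E1 E2.
have [[-> ->]|[-> ->]] : (c = a /\ d = b) \/ (c = b /\ d = a) by lia.
  by left.
by right.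
Qed.

Lemma bef_not_adj e f a b : edge e -> edge f ->
  bef cx1 cx2 cy1 cy2 e f || bef cx1 cx2 cy1 cy2 f e ->
  a \in [:: e.1; e.2] -> b \in [:: f.1; f.2] -> ~ tg_adj tau a b.
Proof.
move=> /and4P[_ _ Le _] /and4P[_ _ Lf _] B; rewrite !inE => Ha Hb.
have Lab : lft a b || lft b a.
  move: B; rewrite /bef /bx2 /by2 /by1 /lft.
  by case/orP: Ha => /eqP ->; case/orP: Hb => /eqP ->; lia.
by move=> /tg_adjP; rewrite /adj; case/orP: Lab => ->; rewrite /= ?andbF.
Qed.

Lemma srtC i j : i < n -> j < n -> i != j -> srt i j = srt j i.
Proof.
move=> Hi Hj /eqP ij; rewrite /srt; case: ltngtP => // E.
by case: ij; apply: (x1_inj cs).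
Qed.

Lemma chain_induced c : chain c -> induced_matching tau c.
Proof.
move=> ch; have Ec e : e \in c -> edge e by apply: chain_edge ch.
have cmp e f : e \in c -> f \in c -> e != f ->
    bef cx1 cx2 cy1 cy2 e f || bef cx1 cx2 cy1 cy2 f e.
  elim: c ch {Ec} => // g c IH ch; rewrite !inE.
  have B x := chain_bef cs ch (e := x); have [_ cc _] := chain_cons ch.
  case/predU1P => [->|ec] /predU1P[->|fc]; rewrite ?eqxx // => ef.
  - by rewrite (B f) ?orbT.
  - by rewrite (B e).
  exact: IH.
split.
- move=> e /Ec /and4P[H1 H2 L a]; apply/tg_adjP; rewrite H1 H2 a andbT /=.
  by apply: contraTneq L => ->; rewrite ltnn.
- elim: c ch {Ec cmp} => //= f c IH ch; have [ef cc _] := chain_cons ch.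
  rewrite IH // andbT; apply/mapP => -[e ec] /unord_inj E.
  have /andP[_] := chain_bef cs ch ec; have [_] := edge_box cs ef.
  by rewrite /by2; case: E => -> /=; lia.
move=> e f ec fc uef; have ef : e != f by apply: contraNneq uef => ->.
have B := cmp e f ec fc ef.
by split; apply: (bef_not_adj (Ec e ec) (Ec f fc) B); rewrite !inE eqxx ?orbT.
Qed.

(** A trapezoid lying between the ends of an edge would separate them, though they intersect. So all
    four pairs are ordered the same way, and the right ends tell which. *)
Lemma separated_bef e f : edge e -> edge f -> bx2 cx2 e <= bx2 cx2 f ->
  lft e.1 f.1 || lft f.1 e.1 -> lft e.1 f.2 || lft f.2 e.1 ->
  lft e.2 f.1 || lft f.1 e.2 -> lft e.2 f.2 || lft f.2 e.2 ->
  bef cx1 cx2 cy1 cy2 e f.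
Proof.
case: e f => [a b] [c d] /and4P[/= Ha Hb Lab +] /and4P[/= Hc Hd Lcd].
have ? := x12 cs Ha; have ? := x12 cs Hb; have ? := x12 cs Hc; have ? := x12 cs Hd.
have ? := y12 cs Ha; have ? := y12 cs Hb; have ? := y12 cs Hc; have ? := y12 cs Hd.
rewrite /adj /lft /bef /bx2 /by1 /by2 /=; lia.
Qed.

Lemma induced_chain M : induced_matching tau M ->
  exists2 c, chain c & size c = size M.
Proof.
case=> adjM UM sepM; pose N := map (fun e => srt e.1 e.2) M.
(* Decreasing right ends, as chains list the rightmost edge first. *)
pose r := [rel f e : nat * nat | bx2 cx2 e <= bx2 cx2 f].
have rT : transitive r by move=> b a c /= H1 H2; apply: leq_trans H2 H1.
have rt : total r by move=> a b; apply: leq_total.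
exists (sort r N); last by rewrite size_sort size_map.
have UN : uniq N.
  apply: (@map_uniq _ _ unord); rewrite -map_comp.
  by rewrite (eq_map (g := unord)) // => e /=; rewrite unord_srt.
have EN e : e \in N -> edge e.
  case/mapP=> p /adjM /tg_adjP /and4P[H1 H2 H3 H4] ->.
  exact: (edge_srt cs).
apply/andP; split.
  by apply/allP => e; rewrite mem_sort; apply: EN.
apply: pairwise_sorted.
have : pairwise [rel f e | r f e && (f != e)] (sort r N).
  rewrite (pairwise_relI r [rel f e | f != e]) -uniq_pairwise sort_uniq UN andbT.
  by rewrite -sorted_pairwise // sort_sorted.
apply: sub_in_pairwise (allss _) => f e; rewrite !mem_sort /= => fN eN.
case/andP => Lr fe.
have [ef ee] := (EN f fN, EN e eN).
have sep a b : a \in [:: e.1; e.2] -> b \in [:: f.1; f.2] -> ~ tg_adj tau a b.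
  have mem_srt (p : nat * nat) x : x \in [:: (srt p.1 p.2).1; (srt p.1 p.2).2] =
    (x \in [:: p.1; p.2]) by rewrite /srt; case: ifP; rewrite //= !inE orbC.
  have /mapP[p pM Ep] := eN; have /mapP[q qM Eq] := fN.
  rewrite Ep Eq !mem_srt !inE.
  have pq : unord p != unord q.
    apply: contraNneq fe => E; apply/eqP; rewrite Ep Eq.
    have /tg_adjP /and4P[H1 H2 H3 _] := adjM p pM.
    by case: (unord_inj E) => -> //=; rewrite srtC // eq_sym.
  have [S1 S2 S3 S4] := sepM _ _ pM qM pq.
  by case/orP=> /eqP->; case/orP=> /eqP->.
have [[He1 He2 Le ae] [Hf1 Hf2 Lf af]] := (and4P ee, and4P ef).
have out1 a b : a \in [:: e.1; e.2] -> b \in [:: f.1; f.2] -> lft a b || lft b a.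
  (* A common end would be adjacent to the other end of [f], against [sep]. *)
  move=> aE bE; have ab : a != b.
    apply/eqP => ab; move: bE; rewrite -ab !inE.
    move: (sep a f.1 aE) (sep a f.2 aE); rewrite !inE !eqxx orbT.
    move=> S1 S2 /orP[/eqP E|/eqP E].
      by apply: (S2 isT); apply/tg_adjP; rewrite E Hf1 Hf2 af andbT; apply: contraTneq Lf => ->; rewrite ltnn.
    apply: (S1 isT); apply/tg_adjP; rewrite E Hf1 Hf2 adjC af andbT.
    by apply: contraTneq Lf => ->; rewrite ltnn.
  have := sep a b aE bE => /tg_adjP; rewrite ab /=.
  have -> : a < n by move: aE; rewrite !inE => /orP[]/eqP->.
  have -> : b < n by move: bE; rewrite !inE => /orP[]/eqP->.
  by rewrite /= /adj => /negP; rewrite negb_and !negbK.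
move: (out1 e.1 f.1) (out1 e.1 f.2) (out1 e.2 f.1) (out1 e.2 f.2).
rewrite !inE !eqxx !orbT => /(_ isT isT) O1 /(_ isT isT) O2 /(_ isT isT) O3 /(_ isT isT) O4.
exact: separated_bef.
Qed.

(** Every edge ends before [2 * n + 1], so by completeness no chain, hence no induced matching, has
    more than [lev d] edges. *)
Lemma dp_maximum d : dp n cx1 cx2 cy1 cy2 (2 * n + 1) (2 * n + 1) d ->
  max_induced_matching tau
    (trace (pa d) (pb d) (lev d) (wa d (lev d)) (wb d (lev d))).
Proof.
move=> D; split.
  apply: chain_induced; case El : (lev d) => [|v] //; rewrite -El.
  by have [] // := dp_sound D (v := lev d); lia.
move=> M /induced_chain[[|e c] ch <-]; rewrite size_trace //=.
have [/and4P[H1 H2 _ _] _ _] := chain_cons ch.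
have Lb : bx2 cx2 e < 2 * n + 1.
  by have := x_range cs H1; have := x_range cs H2; rewrite /bx2; lia.
by have /andP[] := dp_complete D ch Lb.
Qed.

End Model.

(** * The program *)

(* Scalars; [vz] is never written and stays [0]. *)
Local Notation vz := 0 (only parsing).
Local Notation vone := 1 (only parsing).
Local Notation vn := 2 (only parsing).
Local Notation vlim := 3 (only parsing).
Local Notation vx := 4 (only parsing).
Local Notation vK := 5 (only parsing).
Local Notation vsp := 6 (only parsing).
Local Notation vC := 7 (only parsing).
Local Notation vD := 8 (only parsing).
Local Notation vA := 9 (only parsing).
Local Notation vB := 10 (only parsing).
Local Notation vy := 11 (only parsing).
Local Notation vt := 12 (only parsing).
Local Notation vv := 13 (only parsing).
Local Notation vw := 14 (only parsing).
Local Notation vq := 15 (only parsing).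
Local Notation vr := 16 (only parsing).
Local Notation vp := 17 (only parsing).
Local Notation vj := 18 (only parsing).

(* Arrays: the four coordinates of a trapezoid, the owner of an abscissa, the
   fields of [dps], and the trapezoids already passed (identifiers and upper
   right coordinates, from cell 1 on), sorted by upper right coordinate. *)
Local Notation aX1 := 0 (only parsing).
Local Notation aX2 := 1 (only parsing).
Local Notation aY1 := 2 (only parsing).
Local Notation aY2 := 3 (only parsing).
Local Notation aOX := 4 (only parsing).
Local Notation aT := 5 (only parsing).
Local Notation aWA := 6 (only parsing).
Local Notation aWB := 7 (only parsing).
Local Notation aF := 8 (only parsing).
Local Notation aTT := 9 (only parsing).
Local Notation aPA := 10 (only parsing).
Local Notation aPB := 11 (only parsing).
Local Notation aIS := 12 (only parsing).
Local Notation aYS := 13 (only parsing).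

Definition read_cmd : cmd :=
  Block [:: AConst vone 1; ARead vn; AConst vx 0];;
  While vx vn (Block [::
    ARead vr; AStore aX1 vx vr; AStore aOX vr vx;
    ARead vr; AStore aX2 vx vr; AStore aOX vr vx;
    ARead vr; AStore aY1 vx vr; ARead vr; AStore aY2 vx vr;
    AAdd vx vx vone]).

Definition order_cmd : cmd :=
  Block [:: ALoad vq aX1 vC; ALoad vr aX1 vD];;
  If vq vr (Block [:: AAdd vA vC vz; AAdd vB vD vz])
           (Block [:: AAdd vA vD vz; AAdd vB vC vz]).

(** At a new level the table cell means nothing: [vr] is replaced by [vq + 1] so that the last test
    succeeds. *)
Definition update_cmd : cmd :=
  Block [:: ALoad vq aTT vA; ALoad vr aY1 vB];;
  If vr vq (Block [::]) (
    Block [:: ALoad vw aF vA; AAdd vw vw vone; ALoad vq aY2 vA; ALoad vr aY2 vB];;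
    If vq vr (Block [:: AAdd vq vr vz]) (Block [::]);;
    Block [:: ALoad vr aT vw];;
    If vK vw (Block [:: AAdd vK vw vz; AAdd vr vq vone]) (Block [::]);;
    If vq vr (Block [:: AStore aT vw vq; AStore aWA vw vA; AStore aWB vw vB])
             (Block [::])).

Definition process_cmd : cmd := order_cmd;; update_cmd.

Definition search_cmd : cmd :=
  Block [:: AAdd vv vK vz; ALoad vt aT vv];;
  While vy vt (Block [:: ASub vv vv vone; ALoad vt aT vv]).

Definition left_cmd : cmd :=
  Block [:: ALoad vy aY1 vC];;
  search_cmd;;
  Block [:: AStore aF vC vv; AStore aTT vC vt; ALoad vr aWA vv; AStore aPA vC vr;
            ALoad vr aWB vv; AStore aPB vC vr].

Definition pass_cmd : cmd :=
  Block [:: ALoad vy aY1 vC; AAdd vj vsp vz; ALoad vt aYS vj];;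
  While vy vt (
    Block [:: ALoad vD aIS vj];;
    process_cmd;;
    Block [:: ASub vj vj vone; ALoad vt aYS vj]).

(** An abscissa smaller than the right end of its owner is a left end and is skipped. Some
    neighbours were already met in [pass_cmd]; processing an edge twice is harmless. *)
Definition inside_cmd : cmd :=
  Block [:: ALoad vt aX1 vC; ASub vp vx vone];;
  While vt vp (
    Block [:: ALoad vD aOX vp; ALoad vr aX2 vD];;
    If vp vr (Block [::]) process_cmd;;
    Block [:: ASub vp vp vone]).

Definition insert_cmd : cmd :=
  Block [:: ALoad vy aY2 vC; AAdd vj vsp vz; ALoad vt aYS vj];;
  While vy vt (Block [::
    AAdd vp vj vone; ALoad vD aIS vj; AStore aYS vp vt; AStore aIS vp vD;
    ASub vj vj vone; ALoad vt aYS vj]);;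
  Block [:: AAdd vp vj vone; AStore aYS vp vy; AStore aIS vp vC; AAdd vsp vsp vone].

Definition turn_cmd : cmd :=
  Block [:: ALoad vC aOX vx; ALoad vq aX2 vC];;
  If vx vq left_cmd (pass_cmd;; inside_cmd;; insert_cmd);;
  Block [:: AAdd vx vx vone].

Definition sweep_cmd : cmd :=
  Block [:: AAdd vlim vn vn; AAdd vlim vlim vone; AAdd vx vone vz];;
  While vx vlim turn_cmd.

(** Follows [trace]; [vB] is replaced first because both pointers are read at the old [vA]. *)
Definition write_cmd : cmd :=
  Block [:: AAdd vv vK vz; ALoad vA aWA vv; ALoad vB aWB vv];;
  While vz vv (Block [::
    AWrite vA; AWrite vB; ALoad vB aPB vA; ALoad vA aPA vA; ASub vv vv vone]).

Definition matching_cmd : cmd := read_cmd;; sweep_cmd;; write_cmd.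

Lemma matching_cmd_wf : wf matching_cmd.
Proof. by []. Qed.

Definition dpof (s : st) : dps :=
  Dps (sc s vK) (ar s aT) (ar s aWA) (ar s aWB) (ar s aF) (ar s aTT)
      (ar s aPA) (ar s aPB).

(** * Correctness and cost of the sweep *)

Section Correct.
Variables (n : nat) (x1 x2 y1 y2 : nat -> nat).
Hypothesis cs : coords n x1 x2 y1 y2.
Local Notation adj := (adj x1 x2 y1 y2).
Local Notation deg := (deg n x1 x2 y1 y2).
Local Notation dp := (dp n x1 x2 y1 y2).
Local Notation srt := (srt x1).
Local Notation process := (process y1 y2).
Local Notation covered := (covered n x1 x2 y1 y2).

Record base (s : st) : Prop := Base {
  base_one : sc s vone = 1;
  base_zero : sc s vz = 0;
  base_x1 : forall i, i < n -> ar s aX1 i = x1 i;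
  base_x2 : forall i, i < n -> ar s aX2 i = x2 i;
  base_y1 : forall i, i < n -> ar s aY1 i = y1 i;
  base_y2 : forall i, i < n -> ar s aY2 i = y2 i;
  base_own : forall i, i < n -> ar s aOX (x1 i) = i /\ ar s aOX (x2 i) = i
}.

Lemma base_frame ss aa io s s' : frame ss aa io s s' ->
  ~~ has (mem ss) [:: vz; vone] -> ~~ has (mem aa) [:: aX1; aX2; aY1; aY2; aOX] ->
  base s -> base s'.
Proof.
case=> F1 F2 _ /= /norP[n1 /norP[n2 _]].
move=> /norP[m1 /norP[m2 /norP[m3 /norP[m4 /norP[m5 _]]]]] [*].
by split; rewrite ?F1 ?F2.
Qed.

Lemma order_spec s i j : base s -> sc s vC = i -> sc s vD = j -> i < n -> j < n ->
  wp order_cmd (fun s' =>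
    [/\ sc s' vA = (srt i j).1, sc s' vB = (srt i j).2 & tm s' = tm s + 5]) s.
Proof.
move=> b Ei Ej Hi Hj.
apply/wp_seq/wp_block/wp_if => /=; rewrite /upd /= Ei Ej !(base_x1 b) // => L;
  apply: wp_block; rewrite /= /upd /= ?Ei ?Ej ?(base_zero b) ?addn0 /srt.
  by rewrite L; split=> //; lia.
by rewrite ltnNge L; split=> //; lia.
Qed.

Lemma update_spec s e : base s -> e.1 < n -> e.2 < n ->
  sc s vA = e.1 -> sc s vB = e.2 ->
  wp update_cmd (fun s' =>
    dpof s' = process (dpof s) e /\ tm s' <= tm s + 20) s.
Proof.
move=> b H1 H2 E1 E2.
apply/wp_seq/wp_block/wp_if; rewrite /= /upd /= E1 E2 (base_y1 b) // => L.
  apply: wp_block; split; last by rewrite /=; lia.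
  rewrite /process /improves ifF //.
  by apply/negbTE; rewrite negb_and -ltnNge L.
apply/wp_seq/wp_block/wp_seq.
set s1 := foldl _ _ _.
have Q1 : [/\ sc s1 vone = 1, sc s1 vz = 0, sc s1 vA = e.1, sc s1 vB = e.2
    & sc s1 vw = (ar s aF e.1).+1] /\
    [/\ sc s1 vq = y2 e.1, sc s1 vr = y2 e.2, tm s1 <= tm s + 8,
      dpof s1 = dpof s & ar s1 = ar s].
  rewrite /s1 /= /upd /= E1 E2 (base_one b) !(base_y2 b) // addn1 (base_zero b).
  by split; split=> //; lia.
move: s1 Q1 => s1 [[O1 Z1 A1 B1 W1] [q1 r1 T1 D1 R1]].
pose Q2 s2 := [/\ sc s2 vone = 1, sc s2 vz = 0, sc s2 vA = e.1, sc s2 vB = e.2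
    & sc s2 vw = (ar s aF e.1).+1] /\
    [/\ sc s2 vq = by2 y2 e, tm s2 <= tm s + 10, dpof s2 = dpof s & ar s2 = ar s].
apply: (wp_mono (Q := Q2)) => [s2 [[O2 Z2 A2 B2 W2] [q2 T2 D2 R2]]|]; last first.
  apply: wp_if; rewrite q1 r1 => Lq; apply: wp_block;
    rewrite /Q2 /= /upd /= ?q1 ?r1 O1 Z1 A1 B1 W1 /by2.
    by rewrite addn0; split; split=> //; lia.
  by split; split=> //; lia.
have lev2 : sc s2 vK = lev (dpof s) by rewrite -D2.
have tbl2 w : ar s2 aT w = tbl (dpof s) w by rewrite -D2.
apply/wp_seq/wp_block/wp_seq/wp_if; rewrite /= /upd /= lev2 W2 => Lk;
  apply/wp_block/wp_if; rewrite /= /upd /= ?lev2 ?W2 ?q2 ?O2 ?tbl2 => Lt;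
  apply: wp_block; rewrite /dpof /=; (split; last by lia);
  rewrite /process /improves L /=.
- rewrite Lk /set_edge /= /upd /= W2 q2 A2 B2 Z2 R2 addn0.
  by congr Dps; move: Lk => /=; lia.
- by move: Lt; rewrite addn1 ltnn.
- rewrite orbC Lt /set_edge /= /upd /= W2 q2 A2 B2 R2 lev2 /=.
  by congr Dps; move: Lk => /=; lia.
rewrite ifF; first by rewrite /upd /= R2 lev2.
by apply/negbTE; rewrite negb_or -!leqNgt Lk.
Qed.

Lemma process_spec s i j : base s -> sc s vC = i -> sc s vD = j -> i < n -> j < n ->
  wp process_cmd (fun s' =>
    dpof s' = process (dpof s) (srt i j) /\ tm s' <= tm s + 25) s.
Proof.
move=> b Ei Ej Hi Hj; apply: wp_seq.
have := wp_frame (order_spec b Ei Ej Hi Hj).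
apply: wp_mono => s1 [[EA EB T1] F1].
have b1 := base_frame F1 isT isT b.
have He1 : (srt i j).1 < n by rewrite /srt; case: ifP.
have He2 : (srt i j).2 < n by rewrite /srt; case: ifP.
have E : dpof s1 = dpof s by case: F1 => f1 f2 _; rewrite /dpof !f2 // f1.
have := update_spec b1 He1 He2 EA EB.
by apply: wp_mono => s2 [-> T2]; rewrite E; split=> //; lia.
Qed.

Lemma search_spec s i x : base s -> i < n -> sc s vy = y1 i -> x1 i = x ->
  dp x x (dpof s) ->
  wp search_cmd (fun s' => let v := sc s' vv in
    [/\ v <= lev (dpof s), sc s' vt = tbl (dpof s) v, tbl (dpof s) v <= y1 i,
      forall w, v < w <= lev (dpof s) -> y1 i < tbl (dpof s) w
    & tm s' <= tm s + 3 + 3 * deg i]) s.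
Proof.
move=> b Hi Ey Ex D; pose d := dpof s.
pose I k s' := [/\ sc s' vone = 1, sc s' vy = y1 i & sc s' vv = k] /\
  [/\ k <= lev d, sc s' vt = tbl d k, ar s' aT = tbl d,
    forall w, k < w <= lev d -> y1 i < tbl d w
  & tm s' + 3 * k <= tm s + 2 + 3 * lev d].
apply/wp_seq/wp_block/(wp_while (I := I) (k := lev d)).
- split; split; rewrite /= /upd /= ?(base_one b) ?(base_zero b) ?addn0 //; lia.
(* The entry 0 at level 0 is a sentinel. *)
- by move=> s' [[_ -> _] [_ -> _ _ _]]; rewrite (dp_tbl0 D).
- move=> k s' [[O Y V] [Lk T A W Tm]] L; apply: wp_block.
  split; split; rewrite /= /upd /= ?O ?V ?A ?subn1 //; try by move: Lk Tm => /=; lia.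
  move=> w Hw; have [->|Nw] := eqVneq w k.+1; first by move: L; rewrite T Y.
  by apply: W; move: Hw Nw => /=; lia.
move=> k s' [[O Y V] [Lk T A W Tm]] L; rewrite /= V; split=> //.
  by move: L; rewrite T Y.
by have := dp_walk cs D Hi Ex W; rewrite -/d; lia.
Qed.

Lemma left_spec s i x : base s -> sc s vC = i -> i < n -> x1 i = x ->
  dp x x (dpof s) ->
  wp left_cmd (fun s' => dp x.+1 x.+1 (dpof s') /\ tm s' <= tm s + 10 + 3 * deg i) s.
Proof.
move=> b Ei Hi Ex D; apply/wp_seq/wp_block/wp_seq; set s1 := foldl _ _ _.
have b1 : base s1.
  by case: b => *; split.
have Ey : sc s1 vy = y1 i by rewrite /= /upd /= Ei (base_y1 b).
have := wp_frame (search_spec b1 Hi Ey Ex D).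
apply: wp_mono => s2 [[Lv Et Tv W Tm] [F1 F2 _]]; apply: wp_block.
have E2 : dpof s2 = dpof s by rewrite /dpof !F2 // F1.
have C2 : sc s2 vC = i by rewrite F1 //= /upd /= Ei.
split; last by move: Tm; rewrite /=; lia.
suff -> : dpof (foldl aexec s2 [:: AStore aF vC vv; AStore aTT vC vt; ALoad vr aWA vv;
      AStore aPA vC vr; ALoad vr aWB vv; AStore aPB vC vr]) =
    set_vertex (dpof s) i (sc s2 vv).
  exact: (dp_set_vertex cs).
have Et2 : sc s2 vt = ar s2 aT (sc s2 vv) by rewrite Et F2.
by rewrite -E2 /dpof /= /upd /= C2 Et2.
Qed.

Record stk (x sp : nat) (IS YS : nat -> nat) : Prop := Stk {
  stk0 : YS 0 = 0;
  stk_mem : forall j, 0 < j <= sp ->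
    [/\ IS j < n, x2 (IS j) < x & YS j = y2 (IS j)];
  stk_lt : forall i j, i < j <= sp -> YS i < YS j;
  stk_all : forall i, i < n -> x2 i < x -> exists2 j, 0 < j <= sp & IS j = i
}.

Lemma stk_left x sp IS YS i : i < n -> x1 i = x -> stk x sp IS YS ->
  stk x.+1 sp IS YS.
Proof.
move=> Hi Ex [S0 SM SL SA]; split=> // [j /SM[? ? ?]|j Hj Lj].
  by split=> //; apply: ltnW.
apply: SA => //; have := x1_x2 cs Hi Hj; lia.
Qed.

(** A trapezoid that ends before [x2 i] below but after [y1 i] above is a neighbour of [i]. This
    bounds both the walk of [pass_cmd] and the shifts of [insert_cmd]. *)
Lemma stk_count x sp IS YS i k : stk x sp IS YS -> i < n -> x2 i = x ->
  (forall j, k < j <= sp -> y1 i < YS j) -> sp - k <= deg i.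
Proof.
move=> [S0 SM SL SA] Hi Ex Y.
rewrite -(size_iota k.+1 (sp - k)) -(size_map IS); apply: deg_ge.
  rewrite map_inj_in_uniq ?iota_uniq // => a c; rewrite !mem_iota => Ha Hc E.
  have [|_ _ Ya] := SM a; first by lia.
  have [|_ _ Yc] := SM c; first by lia.
  have [L|L|//] := ltngtP a c; first by have := SL a c; rewrite Ya Yc E; lia.
  by have := SL c a; rewrite Ya Yc E; lia.
move=> _ /mapP[j Hj ->]; rewrite mem_iota in Hj.
have [|Jn Jx Jy] := SM j; first by lia.
have := Y j; rewrite Jy => Yj; have ? := x12 cs Jn.
split=> //; first by apply/eqP => E; move: Jx; rewrite E Ex ltnn.
by rewrite /adj /lft; lia.
Qed.

Lemma pass_spec s i x : base s -> sc s vC = i -> i < n -> x2 i = x ->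
  dp x x.+1 (dpof s) -> stk x (sc s vsp) (ar s aIS) (ar s aYS) ->
  wp pass_cmd (fun s' => [/\ dp x x.+1 (dpof s'),
    forall j, j < n -> x2 j < x -> y1 i < y2 j -> covered (dpof s') (srt i j)
    & tm s' <= tm s + 4 + 30 * deg i]) s.
Proof.
move=> b Ei Hi Ex D St; pose sp := sc s vsp.
pose I k s' := [/\ base s', sc s' vC = i, sc s' vy = y1 i, sc s' vj = k & k <= sp] /\
  [/\ sc s' vt = ar s aYS k, ar s' aIS = ar s aIS, ar s' aYS = ar s aYS
    & dp x x.+1 (dpof s')] /\
  [/\ forall j, k < j <= sp -> covered (dpof s') (srt i (ar s aIS j)),
    forall j, k < j <= sp -> y1 i < ar s aYS j
    & tm s' + 30 * k <= tm s + 3 + 30 * sp].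
apply/wp_seq/wp_block/(wp_while (I := I) (k := sp)).
- split; last split; split; rewrite /= /upd /= ?(base_zero b) ?addn0 //; try lia.
    by case: b => *; split.
  by rewrite Ei (base_y1 b).
- by move=> s' [[_ _ -> _ _] [[-> _ _ _] _]]; rewrite (stk0 St).
- move=> k s' [[b' C Y J Lk] [[T EI EY D'] [Cov W Tm]]] L.
  apply/wp_seq/wp_block/wp_seq; set s1 := foldl _ _ _.
  have [|Jn Jx Jy] := stk_mem St (j := k.+1); first by rewrite -/sp; lia.
  set j := ar s aIS k.+1 in Jn Jx Jy.
  have b1 : base s1 by case: b' => *; split.
  have C1 : sc s1 vC = i by [].
  have D1 : sc s1 vD = j by rewrite /= /upd /= J EI.
  have := wp_frame (process_spec b1 C1 D1 Hi Jn).
  apply: wp_mono => s2 [[E2 T2] F]; apply: wp_block.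
  have b2 := base_frame F isT isT b1; case: F => F1 F2 _.
  have a : adj i j.
    rewrite /adj /lft; have := x12 cs Jn; have : y1 i < y2 j by rewrite -Jy -T -Y.
    by lia.
  have [D2 Cj Ce] := dp_step cs D' Hi Jn Ex Jx a.
  rewrite -/(dpof s1) in E2; have Es1 : dpof s1 = dpof s' by [].
  rewrite Es1 in E2; rewrite -E2 in D2 Cj Ce.
  split; last split; split; rewrite /= /upd /= ?F1 ?F2 //= /upd /=
    ?J ?(base_one b') ?subn1 ?EY //; try lia.
  + by case: b2 => *; split.
  + move=> j' Hj'; have [->|N] := eqVneq j' k.+1; first exact: Cj.
    by apply/Ce/Cov; lia.
  + move=> j' Hj'; have [->|N] := eqVneq j' k.+1; first by move: L; rewrite T Y.
    by apply: W; lia.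
  by move: T2 Tm; rewrite /=; lia.
move=> k s' [[b' C Y J Lk] [[T EI EY D'] [Cov W Tm]]] L; split=> //.
  move=> j Hj Lj Yj; have [j' Hj' Ej] := stk_all St Hj Lj.
  (* The list is sorted, so the cells that were not visited hold values at most [y1 i]. *)
  rewrite -Ej; apply: Cov; have [//|Lk'] := ltnP k j'; first by lia.
  have [_ _] := stk_mem St Hj'; rewrite Ej => Ey.
  have : ar s aYS j' <= ar s aYS k.
    by move: Lk'; rewrite leq_eqVlt => /predU1P[-> //|Lk']; apply/ltnW/(stk_lt St); rewrite -/sp; lia.
  by move: L; rewrite T Y; lia.
have := stk_count St Hi Ex W; rewrite -/sp /=; lia.
Qed.

Lemma inside_spec s i x : base s -> sc s vC = i -> sc s vx = x -> i < n -> x2 i = x ->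
  dp x x.+1 (dpof s) ->
  wp inside_cmd (fun s' => [/\ dp x x.+1 (dpof s'),
    forall e, covered (dpof s) e -> covered (dpof s') e,
    forall j, j < n -> x1 i < x2 j < x -> covered (dpof s') (srt i j)
    & tm s' <= tm s + 33 + 60 * deg i]) s.
Proof.
move=> b Ei Evx Hi Ex D.
pose I k s' := [/\ base s', sc s' vC = i, sc s' vt = x1 i, sc s' vp = x1 i + k
     & x1 i + k < x] /\
  [/\ dp x x.+1 (dpof s'), forall e, covered (dpof s) e -> covered (dpof s') e,
    forall j, j < n -> x1 i + k < x2 j < x -> covered (dpof s') (srt i j)
    & tm s' + 30 * (x1 i + k) <= tm s + 2 + 30 * x].
have Lx : x1 i < x by rewrite -Ex (x12 cs).
apply/wp_seq/wp_block/(wp_while (I := I) (k := x - 1 - x1 i)).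
- split; split; rewrite /= /upd /= ?Ei ?(base_x1 b) ?(base_one b) ?Evx //; try lia.
  by case: b => *; split.
- by move=> s' [[_ _ -> -> _] _]; rewrite addn0.
- move=> k s' [[b' C T P Lk] [D' Ce Cov Tm]] _.
  apply/wp_seq/wp_block/wp_seq; set p := x1 i + k.+1 in P Lk Cov Tm.
  have Lp : 0 < p <= 2 * n by have := x_range cs Hi; lia.
  have [j Hj Ep] := x_onto cs Lp.
  have Eo : ar s' aOX p = j by have [Eo1 Eo2] := base_own b' Hj; case: Ep => ->.
  apply: wp_if; rewrite /= /upd /= P Eo (base_x2 b') // => Lj.
    apply: wp_block; apply: wp_block; split; split; rewrite /= /upd /= ?P ?(base_one b') //;
      try lia.
    + by case: b' => *; split.
    + move=> j' Hj' Lj'; apply: Cov => //; have [E|N] := eqVneq p (x2 j'); last by lia.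
      have [_ Eo'] := base_own b' Hj'; move: Eo; rewrite E Eo' => Ej.
      by move: Lj; rewrite -Ej -E ltnn.
  have {Ep Lj} Ep : x2 j = p by case: Ep => // Ep; have := x12 cs Hj; lia.
  set s1 := tick _.
  have b1 : base s1 by case: b' => *; split.
  have C1 : sc s1 vC = i by [].
  have D1 : sc s1 vD = j by [].
  have := wp_frame (process_spec b1 C1 D1 Hi Hj).
  apply: wp_mono => s2 [[E2 T2] F]; apply: wp_block.
  have b2 := base_frame F isT isT b1; case: F => F1 F2 _.
  have Jx : x2 j < x by rewrite Ep.
  have a : adj i j.
    by rewrite /adj /lft; have := x12 cs Hj; lia.
  have [D2 Cj Ce2] := dp_step cs D' Hi Hj Ex Jx a.
  have Es1 : dpof s1 = dpof s' by [].
  rewrite Es1 in E2; rewrite -E2 in D2 Cj Ce2.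
  split; split; rewrite /= /upd /= ?F1 ?F2 //= /upd /= ?P ?(base_one b') //; try lia.
  + by case: b2 => *; split.
  + by move=> e /Ce /Ce2.
  + move=> j' Hj' Lj'; have [E|N] := eqVneq p (x2 j'); last by apply/Ce2/Cov; lia.
    by have <- : j = j' by apply: (x2_inj cs) => //; rewrite Ep.
  by move: T2 Tm; rewrite /=; lia.
move=> k s' [[b' C T P Lk] [D' Ce Cov Tm]] L; split=> //.
  by move=> j Hj Lj; apply: Cov => //; lia.
by have := deg_width cs Hi; move: Tm => /=; lia.
Qed.

Lemma insert_spec s i x : base s -> sc s vC = i -> i < n -> x2 i = x ->
  stk x (sc s vsp) (ar s aIS) (ar s aYS) ->
  wp insert_cmd (fun s' => stk x.+1 (sc s' vsp) (ar s' aIS) (ar s' aYS) /\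
    tm s' <= tm s + 8 + 7 * deg i) s.
Proof.
move=> b Ei Hi Ex St; pose sp := sc s vsp.
pose I k s' := [/\ sc s' vone = 1, sc s' vC = i, sc s' vy = y2 i, sc s' vj = k & k <= sp] /\
  [/\ sc s' vt = ar s aYS k, sc s' vsp = sp,
    forall j, j <= k -> ar s' aIS j = ar s aIS j /\ ar s' aYS j = ar s aYS j &
    forall j, k < j <= sp ->
      ar s' aIS j.+1 = ar s aIS j /\ ar s' aYS j.+1 = ar s aYS j] /\
  ((forall j, k < j <= sp -> y2 i < ar s aYS j) /\
   tm s' + 7 * k <= tm s + 3 + 7 * sp).
apply/wp_seq/wp_block/wp_seq/(wp_while (I := I) (k := sp)).
- split; last split; split; rewrite /= /upd /= ?(base_one b) ?(base_zero b) ?addn0 //; try lia.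
  by rewrite Ei (base_y2 b).
- by move=> s' [[_ _ -> _ _] [[-> _ _ _] _]]; rewrite (stk0 St).
- move=> k s' [[O C Y J Lk] [[T P Lo Hi'] [W Tm]]] L; apply: wp_block.
  have [Lk1 Lk2] := Lo k.+1 (leqnn _).
  split; last split; split; rewrite /= /upd /= ?O ?J ?subn1 ?addn1 //; try lia.
  + have [_ <-] := Lo k (leqnSn _).
    by rewrite ifF //; lia.
  + by move=> j Hj; rewrite !ifF; [apply: Lo|..]; lia.
  + move=> j Hj; have [->|N] := eqVneq j k.+1; first by rewrite eqxx Lk1 T.
    by rewrite !ifF; [apply: Hi'|..]; lia.
  move=> j' Hj'; have [->|N] := eqVneq j' k.+1; first by move: L; rewrite T Y.
  by apply: W; lia.
move=> k s' [[O C Y J Lk] [[T P Lo Hi'] [W Tm]]] L; apply: wp_block.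
case: (St) => S0 SM SL SA.
rewrite /= /upd /= O C Y J P !addn1; split; last first.
  (* What lies above [y2 i] also lies above [y1 i], so the shifted cells hold neighbours of [i]. *)
  have W' j : k < j <= sp -> y1 i < ar s aYS j by move/W; have := y12 cs Hi; lia.
  by have := stk_count St Hi Ex W'; rewrite -/sp; lia.
have Lyk : ar s aYS k < y2 i.
  move: L; rewrite T Y leq_eqVlt => /predU1P[E|//].
  case: k Lk E {T Lo Hi' W Tm J} => [|k] Lk E; first by have := y12 cs Hi; lia.
  have [|Mn Mx My] := SM k.+1; first by rewrite -/sp; lia.
  have Ek : ar s aIS k.+1 = i by apply: (y2_inj cs) => //; rewrite -My.
  by move: Mx; rewrite Ek Ex ltnn.
have EIS j : j <= sp.+1 -> (if j == k.+1 then i else ar s' aIS j) =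
    if j <= k then ar s aIS j else if j == k.+1 then i else ar s aIS j.-1.
  move=> Lj; have [Lk'|Lk'] := leqP j k; first by rewrite ifF; [have [] := Lo j Lk'|lia].
  case: eqP => // N; case: j Lj Lk' N => // j Lj Lk' N.
  by have [|-> _] := Hi' j; [lia|].
have EYS j : j <= sp.+1 -> (if j == k.+1 then y2 i else ar s' aYS j) =
    if j <= k then ar s aYS j else if j == k.+1 then y2 i else ar s aYS j.-1.
  move=> Lj; have [Lk'|Lk'] := leqP j k; first by rewrite ifF; [have [] := Lo j Lk'|lia].
  case: eqP => // N; case: j Lj Lk' N => // j Lj Lk' N.
  by have [|_ ->] := Hi' j; [lia|].
split.
- by have [_ E0] := Lo 0 isT; rewrite /= E0.
- move=> j Hj; cbv beta; rewrite EIS ?EYS; try lia.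
  have [Lj|Lj] := leqP j k.
    by have [|? ? ?] := SM j; [rewrite -/sp; lia|split=> //; apply: ltnW].
  case: eqP => N; first by rewrite Ex.
  by have [|? ? ?] := SM j.-1; [rewrite -/sp; lia|split=> //; apply: ltnW].
- move=> a c Hac; cbv beta; rewrite !EYS; try lia.
  have SL' u v : u < v <= sp -> ar s aYS u < ar s aYS v by apply: SL.
  have Ka : a <= k -> ar s aYS a <= ar s aYS k.
    by rewrite leq_eqVlt => /predU1P[-> //|La]; apply/ltnW/SL'; lia.
  have [La|La] := leqP a k.
    have [Lc|Lc] := leqP c k; first by apply: SL'; lia.
    by case: eqP => N; [have := Ka La; lia|apply: SL'; lia].
  have -> : (c <= k) = false by lia.
  have -> : (c == k.+1) = false by lia.
  by case: eqP => N; [apply: W; lia|apply: SL'; lia].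
move=> a Ha La; have [->|N] := eqVneq a i.
  by exists k.+1; [lia|cbv beta; rewrite eqxx].
have [|j Hj Ej] := SA a Ha.
  have : x2 a <> x2 i by move/(x2_inj cs Ha Hi) => E; rewrite E eqxx in N.
  by lia.
rewrite -/sp in Hj; have [Lj|Lj] := leqP j k.
  by exists j; [lia|cbv beta; rewrite EIS ?Lj //; lia].
exists j.+1; first by lia.
by cbv beta; rewrite EIS; [rewrite !ifF //; lia|lia].
Qed.

Lemma turn_spec s x : base s -> sc s vx = x -> 0 < x <= 2 * n ->
  dp x x (dpof s) -> stk x (sc s vsp) (ar s aIS) (ar s aYS) ->
  wp turn_cmd (fun s' => [/\ sc s' vx = x.+1, dp x.+1 x.+1 (dpof s'),
    stk x.+1 (sc s' vsp) (ar s' aIS) (ar s' aYS)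
    & tm s' < tm s + 100 * (deg (ar s aOX x)).+1]) s.
Proof.
move=> b Evx Lx D St; have [i Hi Ei] := x_onto cs Lx.
have Eo : ar s aOX x = i by have [? ?] := base_own b Hi; case: Ei => ->.
apply/wp_seq/wp_block/wp_seq; set s1 := foldl _ _ _.
have b1 : base s1 by case: b => *; split.
have C1 : sc s1 vC = i by rewrite /= /upd /= Evx.
have X1 : sc s1 vx = x by [].
have Q1 : sc s1 vq = x2 i by rewrite /= /upd /= Evx Eo (base_x2 b).
have T1 : tm s1 = tm s + 2 by rewrite /=; lia.
have b1' : base (tick s1) by case: b1 => *; split.
rewrite Eo; apply: wp_if; rewrite X1 Q1 => L.
  have {}Ei : x1 i = x by case: Ei L => // ->; rewrite ltnn.
  have := wp_frame (left_spec b1' C1 Hi Ei D).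
  apply: wp_mono => s2 [[D2 T2] F2]; apply: wp_block.
  have b2 := base_frame F2 isT isT b1'; case: F2 => F1 F2 _.
  split; rewrite /= /upd /= ?F1 //= ?(F2 aIS) ?(F2 aYS) //=.
  - by rewrite /upd /= Evx (base_one b) addn1.
  - exact: (stk_left Hi Ei St).
  by move: T2; rewrite /=; lia.
have {L}Ei : x2 i = x by case: Ei => // Ei; have := x12 cs Hi; lia.
have := wp_frame (pass_spec b1' C1 Hi Ei (dp_weaken D) St).
move=> W; apply: wp_seq; apply: wp_mono W => s2 [[D2 Cov2 T2] F2].
have b2 := base_frame F2 isT isT b1'; case: F2 => F2 G2 _.
have C2 : sc s2 vC = i by rewrite F2.
have X2 : sc s2 vx = x by rewrite F2.
have := wp_frame (inside_spec b2 C2 X2 Hi Ei D2).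
move=> W; apply: wp_seq; apply: wp_mono W => s3 [[D3 Ce3 Cov3 T3] F3].
have b3 := base_frame F3 isT isT b2; case: F3 => F3 G3 _.
have C3 : sc s3 vC = i by rewrite F3.
have St3 : stk x (sc s3 vsp) (ar s3 aIS) (ar s3 aYS).
  by rewrite F3 // !G3 // F2 // !G2.
have := wp_frame (insert_spec b3 C3 Hi Ei St3).
apply: wp_mono => s4 [[St4 T4] F4]; apply: wp_block.
have b4 := base_frame F4 isT isT b3; case: F4 => F4 G4 _.
split; rewrite /= /upd /=.
- by rewrite (base_one b4) F4 // F3 // X2 addn1.
- suff -> : dpof (set_sc s4 vx (sc s4 vx + sc s4 vone)) = dpof s3.
    apply: (dp_close cs D3 Hi Ei) => j Hj Lj a.
    (* A neighbour not above [y1 i] must end after [x1 i], or it would be to the left of [i]; the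
       scan then meets its right end. *)
    have [Ly|Ly] := ltnP (y1 i) (y2 j); first by apply/Ce3/Cov2.
    apply: Cov3 => //; rewrite Lj andbT ltnNge; apply/negP => Lj'.
    have : x2 j <> x1 i by move/esym; apply: (x1_x2 cs).
    by move: a; rewrite /adj /lft; lia.
  by rewrite /dpof /= /upd /= F4 // !G4.
- exact: St4.
by move: T2 T1; rewrite /=; lia.
Qed.

Lemma sweep_spec s : base s -> sc s vn = n -> sc s vK = 0 -> ar s aT 0 = 0 ->
  sc s vsp = 0 -> ar s aYS 0 = 0 ->
  wp sweep_cmd (fun s' => dp (2 * n + 1) (2 * n + 1) (dpof s') /\
    tm s' <= tm s + 4 + \sum_(p <- iota 1 (2 * n)) 100 * (deg (ar s aOX p)).+1) s.
Proof.
move=> b En EK ET Esp EYS; pose f p := 100 * (deg (ar s aOX p)).+1.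
(* [k] abscissas remain, and the sum over them is the time still available. *)
pose I k s' := let x := 2 * n + 1 - k in
  [/\ base s', sc s' vlim = 2 * n + 1, sc s' vx = x, k <= 2 * n
     & ar s' aOX = ar s aOX] /\
  [/\ dp x x (dpof s'), stk x (sc s' vsp) (ar s' aIS) (ar s' aYS)
     & tm s' + \sum_(p <- iota x k) f p <= tm s + 3 + \sum_(p <- iota 1 (2 * n)) f p].
have x1' : 2 * n + 1 - 2 * n = 1 by lia.
apply/wp_seq/wp_block/(wp_while (I := I) (k := 2 * n)).
- split; split; rewrite ?x1' /= /upd /= ?En ?(base_zero b) ?(base_one b) //; try lia.
  + by case: b => *; split.
  + exact: (dp_init cs).
  rewrite Esp; split=> // [j|i j|i Hi]; try lia.
  by have := x12 cs Hi; lia.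
- by move=> s' [[_ -> -> _ _] _]; rewrite subn0.
- move=> k s' [[b' El Ex Lk Eo] [D St Tm]] _.
  set x := 2 * n + 1 - k.+1 in Ex D St Tm.
  have Ex' : 2 * n + 1 - k = x.+1 by rewrite /x; lia.
  have bt : base (tick s') by case: b' => *; split.
  have Lx : 0 < x <= 2 * n by rewrite /x; lia.
  have := wp_frame (turn_spec bt Ex Lx D St).
  apply: wp_mono => s2 [[X2 D2 St2 T2] F2].
  have b2 := base_frame F2 isT isT bt; case: F2 => F2 G2 _.
  rewrite /I Ex'; split; split=> //; rewrite ?F2 ?G2 //; first by lia.
  by move: T2 Tm; rewrite /= big_cons /= Eo -/(f x); lia.
move=> k s' [[b' El Ex Lk Eo] [D St Tm]]; rewrite El Ex => L.
have k0 : k = 0 by lia.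
rewrite k0 subn0 big_nil addn0 in D Tm; split=> //.
by move: Tm; rewrite /f /=; lia.
Qed.

End Correct.

Lemma write_spec s : sc s vone = 1 -> sc s vz = 0 ->
  let d := dpof s in
  wp write_cmd (fun s' =>
    out s' = out s ++ encode_pairs
      (trace (pa d) (pb d) (lev d) (wa d (lev d)) (wb d (lev d))) /\
    tm s' <= tm s + 4 + 6 * lev d) s.
Proof.
move=> O Z d; set target := out s ++ _.
pose I k s' := [/\ sc s' vone = 1, sc s' vz = 0 & sc s' vv = k] /\
  [/\ ar s' aPA = pa d, ar s' aPB = pb d,
    out s' ++ encode_pairs (trace (pa d) (pb d) k (sc s' vA) (sc s' vB)) = target
    & tm s' + 6 * k <= tm s + 3 + 6 * lev d].
apply/wp_seq/wp_block/(wp_while (I := I) (k := lev d)).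
- by split; split; rewrite /= /upd /= ?O ?Z ?addn0 //; lia.
- by move=> s' [[_ -> ->] _].
- move=> k s' [[O' Z' V] [A B E Tm]] _; apply: wp_block.
  split; split; rewrite /= /upd /= ?O' ?V ?subn1 //; last by move: Tm => /=; lia.
  by rewrite A B -E -!cats1 -!catA.
move=> k s' [[O' Z' V] [A B E Tm]]; rewrite Z' V leqn0 => /eqP k0.
rewrite k0 /= cats0 in E Tm; rewrite /= E; split=> //.
by move: Tm => /=; lia.
Qed.

(** * Reading the input and the total running time *)

Section Main.
Variable tau : seq trap.
Hypothesis Ht : trapezoid_model tau.
Local Notation n := (size tau).
Local Notation deg := (deg n (cx1 tau) (cx2 tau) (cy1 tau) (cy2 tau)).
Local Notation base := (base n (cx1 tau) (cx2 tau) (cy1 tau) (cy2 tau)).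
Let cs := model_coords Ht.

Lemma read_spec : wp read_cmd (fun s' =>
  [/\ base s', sc s' vn = n, out s' = [::] & tm s' <= 4 + 12 * n])
  (st_init (encode_model tau)).
Proof.
pose enc (A : trap) := [:: tx1 A; tx2 A; ty1 A; ty2 A].
pose I k s' := let i := n - k in
  [/\ sc s' vone = 1, sc s' vz = 0, sc s' vx = i, sc s' vn = n & k <= n] /\
  [/\ inp s' = flatten (map enc (drop i tau)), out s' = [::],
      tm s' + 12 * k <= 3 + 12 * n &
      forall j, j < i ->
      [/\ ar s' aX1 j = cx1 tau j, ar s' aX2 j = cx2 tau j, ar s' aY1 j = cy1 tau j
        & ar s' aY2 j = cy2 tau j] /\
      (ar s' aOX (cx1 tau j) = j /\ ar s' aOX (cx2 tau j) = j)].
apply/wp_seq/wp_block/(wp_while (I := I) (k := n)).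
- by rewrite /I subnn drop0; split; split.
- by move=> s' [[_ _ -> -> _] _]; rewrite subn0.
- move=> k s' [[O Z X N Lk] [Ip Op Tm Hj]] _; apply: wp_block.
  set i := n - k.+1 in X Ip Hj; have Hi : i < n by rewrite /i; lia.
  have Ei : n - k = i.+1 by rewrite /i; lia.
  rewrite (drop_nth (Trap 0 0 0 0) Hi) /= in Ip.
  rewrite /I Ei; split; split; rewrite /= /upd /= ?Ip ?X ?O ?addn1 //; try lia.
  move=> j; rewrite ltnS leq_eqVlt => /predU1P[->|Lj].
    rewrite !eqxx; split=> //.
    split=> //; case: eqP => // _; by rewrite eqxx.
  have Hjn : j < n by apply: ltn_trans Lj Hi.
  have [[-> -> -> ->] [-> ->]] := Hj j Lj.
  have ji : (j == i) = false by apply/negbTE; lia.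
  (* Abscissas are distinct, so the owners stored earlier are not overwritten. *)
  have E1 : (cx1 tau j == cx1 tau i) = false.
    by apply/negbTE/eqP => /(x1_inj cs Hjn Hi); lia.
  have E2 : (cx1 tau j == cx2 tau i) = false.
    by apply/negbTE/eqP; apply: (x1_x2 cs).
  have E3 : (cx2 tau j == cx1 tau i) = false.
    by apply/negbTE/eqP => /esym; apply: (x1_x2 cs).
  have E4 : (cx2 tau j == cx2 tau i) = false.
    by apply/negbTE/eqP => /(x2_inj cs Hjn Hi); lia.
  by rewrite !ji -/(cx1 tau i) -/(cx2 tau i) E1 E2 E3 E4.
move=> k s' [[O Z X N Lk] [Ip Op Tm Hj]]; rewrite X N => L.
have k0 : k = 0 by lia.
rewrite k0 subn0 in Hj Tm; split=> //; last by move: Tm => /=; lia.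
by split=> // j /Hj [[? ? ? ?]].
Qed.

Lemma matching_spec m : num_edges tau m ->
  wp matching_cmd (fun s' => tm s' <= 400 * (m + n + 1) /\
    exists2 M, out s' = encode_pairs M & max_induced_matching tau M)
  (st_init (encode_model tau)).
Proof.
move=> Em; apply: wp_seq; have := wp_frame read_spec.
apply: wp_mono => s1 [[b1 N1 O1 T1] [F1 G1 _]]; apply: wp_seq.
have := sweep_spec cs b1 N1 (F1 vK isT) _ (F1 vsp isT) _.
rewrite (G1 aT) // (G1 aYS) // => /(_ erefl erefl) W; move: (wp_frame W).
apply: wp_mono => s2 [[D2 T2] F2].
have b2 := base_frame F2 isT isT b1; case: F2 => F2 G2 /(_ isT) [_ E2].
have := write_spec (base_one b2) (base_zero b2).
apply: wp_mono => s3 [O3 T3]; split; last first.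
  eexists; first by rewrite O3 E2 O1.
  exact: dp_maximum.
have Ln : lev (dpof s2) <= n.
  have [->//|L0] := posnP (lev (dpof s2)).
  have [|Ch _ _] := dp_sound D2 (v := lev (dpof s2)); first by rewrite L0 leqnn.
  by have := size_chain cs Ch; rewrite size_trace.
move: T2; rewrite (sum_own (fun i => 100 * (deg i).+1) cs (base_own b1)).
have -> : \sum_(i <- iota 0 n) 100 * (deg i).+1 =
    100 * (n + \sum_(i <- iota 0 n) deg i).
  rewrite -big_distrr /=; congr (_ * _).
  under eq_bigr do rewrite -add1n.
  by rewrite big_split /= sum1_size size_iota.
(* Reading and writing cost [O(n)], and the sweep about [200 * n + 400 * m]. *)
by have := sum_deg Ht Em; lia.
Qed.

End Main.

(* There is a RAM program P and a constant c such that on every trapezoid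
   model tau with n trapezoids and m edges, P halts within c*(m+n+1) steps
   and outputs a maximum induced matching of G(tau). *)
Theorem theorem3 :
  exists (P : seq instr) (c : nat),
    forall (tau : seq trap) (m : nat),
      trapezoid_model tau -> num_edges tau m ->
      exists s M,
        [/\ ram_run P (c * (m + size tau + 1)) (ram_init (encode_model tau)) = Some s,
            rs_out s = encode_pairs M
          & max_induced_matching tau M].
Proof.
(* A bound of [400 * (m + n + 1)] on [tm], at eight RAM steps per unit. *)
exists (code 0 matching_cmd), (8 * 400) => tau m Ht Em.
have [s [E [T [M EM HM]]]] := matching_spec Ht Em.
have L : 8 * tm s <= 8 * 400 * (m + size tau + 1) by lia.
have [s' [R O]] := ram_run_code matching_cmd_wf E L.
by exists s', M; rewrite O.
Qed.
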